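(* Let $\Sigma\subseteq\mathbb{R}^2$ be open and let $\Omega=\Sigma\times\left]-1/2,1/2\right[$ with top and bottom identified (i.e. $\Omega=\Sigma\times(\mathbb{R}/\mathbb{Z})$) be equipped with a Riemannian metric $g$ such that $\sup\{\|\nabla_Ye_3\|_\infty: Y\in T^0_{1,c}(\Omega),\ \|Y\|_\infty\le1\}<\infty$, where $e_3=(0,0,1)$ is the constant coordinate vector field. Then for all $\eta\in\mathbb{R}$ with $|\eta|$ small enough, the set $$(1+\eta\mathcal L_{e_3})\big[\Lambda^k(\Omega)\cap\operatorname{dom}(\mathcal L_{e_3})\big]\cap\operatorname{dom}(\mathring d)$$ is dense in $\operatorname{dom}(\mathring d)$ (with respect to the graph norm of $\mathring d$).
   Context: $n=3$, $M=\Omega$ with the smooth (hence periodic in the third variable) metric $g$ and the standard orientation; $\nabla$ is the Levi-Civita connection. $\Lambda^k(\Omega)$ denotes the smooth $k$-forms on $\Omega$, $\Lambda^k_c(\Omega)$ those with compact support, $L_2^k(\Omega)$ the (real) Hilbert space of square-integrable $k$-forms with respect to $g$ and its volume, $\ast$ the Hodge star, and $T^0_{1,c}(\Omega)$ the compactly supported smooth vector fields on $\Omega$. $\mathcal L_{X,c}$ is the Lie derivative along a smooth vector field $X$ with domain $\Lambda_c^k(\Omega)\subseteq L_2^k(\Omega)$ (in every degree), and $\mathcal L_X:=-\ast\mathcal L_{X,c}^*\ast$ as an operator in $L_2^k(\Omega)$. $d_c$ is the exterior derivative with domain $\Lambda_c^k(\Omega)$ as an operator $L_2^k(\Omega)\to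 L_2^{k+1}(\Omega)$, and $\mathring d:=\overline{d_c}$. In the setting considered, $\mathcal L_{e_3}$ equals $\partial_3$ with periodic boundary conditions up to bounded zeroth-order terms and is quasi-skew-selfadjoint, i.e. $\operatorname{dom}(\mathcal L_{e_3})=\operatorname{dom}(\mathcal L_{e_3}^* )$ and $\mathcal L_{e_3}+\mathcal L_{e_3}^*$ is bounded. *)

(* Defs.v *)
From HB Require Import structures.
From mathcomp Require Import all_boot all_order all_algebra fingroup perm.
From mathcomp Require Import all_classical all_reals all_analysis.

Set Implicit Arguments.
Unset Strict Implicit.
Unset Printing Implicit Defensive.

Import Order.TTheory GRing.Theory Num.Theory.
Import numFieldNormedType.Exports.

Local Open Scope classical_set_scope.
Local Open Scope ring_scope.

(* The 3-manifold Sigma x (R/Z) is handled through its cover Sigma x R, here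
   called Omega: functions on the manifold are functions on Sigma x R that are
   1-periodic in the last variable, and integrals over it are integrals over
   the fundamental cell Sigma x ]-1/2, 1/2[.  All functions are total on R^3;
   their values outside Sigma x R are irrelevant. *)

Definition Omega (R : realType) (Sigma : set (R * R)) : set (R * R * R) :=
  Sigma `*` [set: R].

Definition cell (R : realType) (Sigma : set (R * R)) : set (R * R * R) :=
  Sigma `*` `]- 2^-1, 2^-1[.

Definition ebase (R : realType) (i : 'I_3) : R * R * R :=
  ((i == 0)%:R, (i == 1)%:R, (i == 2)%:R).

Definition partial (R : realType) (i : 'I_3) (f : R * R * R -> R) :
    R * R * R -> R :=
  fun x => 'D_(ebase R i) f x.

(* All iterated partial derivatives exist and are continuous. *)
Definition smooth_on (R : realType) (U : set (R * R * R)) (f : R * R * R -> R) :=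
  forall (s : seq 'I_3) (x : R * R * R), U x ->
    {for x, continuous (foldr (@partial R) f s)} /\
    forall i, derivable (foldr (@partial R) f s) x (ebase R i).

Definition periodic3 (R : realType) (Sigma : set (R * R)) (T : Type)
    (f : R * R * R -> T) :=
  forall x, Omega Sigma x -> f (x.1, x.2 + 1) = f x.

(* A subset of Sigma x (R/Z) is contained in a compact one iff it is contained
   in K x (R/Z) for some compact K included in Sigma. *)
Definition supp_compact (R : realType) (Sigma : set (R * R))
    (f : R * R * R -> Prop) :=
  exists K : set (R * R), [/\ compact K, K `<=` Sigma &
    forall x, Omega Sigma x -> ~ K x.1 -> f x].

Section Riemannian.
Context (R : realType) (Sigma : set (R * R)).

Local Notation pt := (R * R * R)%type.

(* g x is the matrix (g_ij) of the metric in the standard coordinates. *)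
Definition riemannian_metric (g : pt -> 'M[R]_3) :=
  [/\ forall i j, smooth_on (Omega Sigma) (fun x => g x i j),
      periodic3 Sigma g,
      forall x, Omega Sigma x -> (g x)^T = g x &
      forall x (v : 'rV[R]_3), Omega Sigma x -> v != 0 ->
        0 < (v *m g x *m v^T) 0 0].

Definition smooth_vf (X : pt -> 'rV[R]_3) :=
  (forall i, smooth_on (Omega Sigma) (fun x => X x 0 i)) /\ periodic3 Sigma X.

Definition smooth_vf_c (X : pt -> 'rV[R]_3) :=
  smooth_vf X /\ supp_compact Sigma (fun x => X x = 0).

Definition e3 : pt -> 'rV[R]_3 := fun=> delta_mx 0 2.

Variable g : pt -> 'M[R]_3.

Definition ginv (x : pt) : 'M[R]_3 := invmx (g x).

Definition vnorm (x : pt) (v : 'rV[R]_3) : R :=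
  Num.sqrt ((v *m g x *m v^T) 0 0).

Definition vf_supnorm (X : pt -> 'rV[R]_3) : \bar R :=
  ereal_sup [set (vnorm x (X x))%:E | x in Omega Sigma].

(* christoffel x l i j is Gamma^l_ij. *)
Definition christoffel (x : pt) (l i j : 'I_3) : R :=
  2^-1 * \sum_(m < 3) ginv x l m *
    (partial i (fun y => g y j m) x + partial j (fun y => g y i m) x
     - partial m (fun y => g y i j) x).

Definition nabla (Y X : pt -> 'rV[R]_3) : pt -> 'rV[R]_3 := fun x =>
  \row_l (\sum_(i < 3) Y x 0 i * partial i (fun y => X y 0 l) x
          + \sum_(i < 3) \sum_(j < 3) christoffel x l i j * Y x 0 i * X x 0 j).

Definition bounded_nabla (X : pt -> 'rV[R]_3) :=
  (ereal_sup [set vf_supnorm (nabla Y X) | Y in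
     [set Y | smooth_vf_c Y /\ (vf_supnorm Y <= 1)%E]] < +oo)%E.

(* A k-form is given by its components a_I, where I runs over all multi-indices
   {0,...,k-1} -> {0,1,2}, so that
     a = 1/k! \sum_I a_I dx^I(0) /\ ... /\ dx^I(k-1)
   with (a_I)_I alternating. *)
Definition midx (k : nat) := {ffun 'I_k -> 'I_3}.

Definition kform (k : nat) := pt -> midx k -> R.

Definition alternating_comp k (a : midx k -> R) :=
  forall (I : midx k) (s : 'S_k), a [ffun p => I (s p)] = (-1) ^+ s * a I.

Definition levi_civita (s : seq 'I_3) : R :=
  \det (\matrix_(i < 3, j < 3) (nth 0 s i == j)%:R).

Definition raise k (x : pt) (a : midx k -> R) : midx k -> R := fun I =>
  \sum_(J : midx k) (\prod_(p < k) ginv x (I p) (J p)) * a J.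

(* Normalized so that dx^I(0) /\ ... /\ dx^I(k-1), for increasing I, are
   orthonormal in the Euclidean case. *)
Definition fdot k (x : pt) (a b : midx k -> R) : R :=
  (k`!)%:R^-1 * \sum_(I : midx k) raise x a I * b I.

Definition vol (x : pt) : R := Num.sqrt (\det (g x)).

(* The Hodge star from k-forms to l-forms, to be used with k + l = 3. *)
Definition hodge k l (a : kform k) : kform l := fun x J =>
  (k`!)%:R^-1 * vol x *
    \sum_(I : midx k) raise x (a x) I * levi_civita (codom I ++ codom J).

Arguments hodge {k} l a _ _.

Definition dform k (a : kform k) : kform k.+1 := fun x I =>
  \sum_(j < k.+1) (-1) ^+ j *
    partial (I j) (fun y => a y [ffun p => I (lift j p)]) x.

Definition lie k (X : pt -> 'rV[R]_3) (a : kform k) : kform k := fun x I =>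
  \sum_(m < 3) X x 0 m * partial m (fun y => a y I) x
  + \sum_(p < k) \sum_(m < 3) partial (I p) (fun y => X y 0 m) x *
      a x [ffun q => if q == p then m else I q].

Definition smooth_form k (a : kform k) :=
  [/\ forall I, smooth_on (Omega Sigma) (a^~ I),
      periodic3 Sigma a &
      forall x, Omega Sigma x -> alternating_comp (a x)].

Definition smooth_form_c k (a : kform k) :=
  smooth_form a /\ supp_compact Sigma (fun x => a x = fun=> 0).

Local Notation mpt :=
  (measurableTypeR R * measurableTypeR R * measurableTypeR R)%type.

Definition leb3 : {measure set mpt -> \bar R} :=
  ((@lebesgue_measure R \x @lebesgue_measure R) \x @lebesgue_measure R)%E.

(* Elements of L_2^k(Omega) are represented by forms on the cell; two forms
   that are equal almost everywhere on the cell represent the same element. *)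
Definition L2form k (a : kform k) :=
  [/\ forall I, measurable_fun (cell Sigma : set mpt) (fun x : mpt => a x I : R),
      forall x, cell Sigma x -> alternating_comp (a x) &
      (\int[leb3]_(x in cell Sigma) (fdot x (a x) (a x) * vol x)%:E < +oo)%E].

Definition form_aeq k (a b : kform k) := ae_eq leb3 (cell Sigma) a b.

Definition L2dot k (a b : kform k) : R :=
  Rintegral leb3 (cell Sigma) (fun x => fdot x (a x) (b x) * vol x).

Definition fsub k (a b : kform k) : kform k := fun x I => a x I - b x I.

Definition L2dist k (a b : kform k) : R :=
  Num.sqrt (L2dot (fsub a b) (fsub a b)).

(* Operators from L_2^k to L_2^l are represented by their graphs. *)
Definition operator k l := kform k -> kform l -> Prop.

Definition dom k l (T : operator k l) (u : kform k) := exists v, T u v.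

Definition adjoint k l (T : operator k l) : operator l k := fun v w =>
  [/\ L2form v, L2form w & forall u Tu, T u Tu -> L2dot Tu v = L2dot u w].

Definition graph_dist k l (u u' : kform k) (v v' : kform l) : R :=
  Num.sqrt (L2dist u u' ^+ 2 + L2dist v v' ^+ 2).

Definition op_closure k l (T : operator k l) : operator k l := fun u v =>
  [/\ L2form u, L2form v & forall eps : R, 0 < eps ->
    exists u' v', T u' v' /\ graph_dist u u' v v' < eps].

Definition graph_dense k l (T : operator k l) (D : set (kform k)) :=
  D `<=` dom T /\
  forall u v, T u v -> forall eps : R, 0 < eps ->
    exists u' v', [/\ D u', T u' v' & graph_dist u u' v v' < eps].

Definition d_c k : operator k k.+1 := fun u v =>
  smooth_form_c u /\ v = dform u.

Definition d_ring k : operator k k.+1 := op_closure (@d_c k).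

Definition lie_c k (X : pt -> 'rV[R]_3) : operator k k := fun u v =>
  smooth_form_c u /\ v = lie X u.

(* L_X = - * (L_{X,c})^* *, the adjoint being taken on (3-k)-forms. *)
Definition lie_op k (X : pt -> 'rV[R]_3) : operator k k := fun u v =>
  [/\ L2form u, L2form v & exists w : kform (3 - k),
    adjoint (@lie_c (3 - k) X) (hodge (3 - k) u) w /\
    form_aeq v (fun x I => - hodge k w x I)].

(* (1 + eta L_X) [Lambda^k(Omega) \cap dom L_X] *)
Definition one_add_lie_image k (X : pt -> 'rV[R]_3) (eta : R) : set (kform k) :=
  [set w | exists u v, [/\ smooth_form u, lie_op X u v &
     form_aeq w (fun x I => u x I + eta * v x I)]].

End Riemannian.

(* Main.v *)
From HB Require Import structures.
Require Import Defs.
From mathcomp Require Import all_boot all_order all_algebra fingroup perm.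
From mathcomp Require Import all_classical all_reals all_analysis.
From mathcomp Require Import measurable_realfun.
From mathcomp Require Import ring lra.

Set Implicit Arguments.
Unset Strict Implicit.
Unset Printing Implicit Defensive.

Import Order.TTheory GRing.Theory Num.Theory.
Import numFieldNormedType.Exports.

Local Open Scope classical_set_scope.
Local Open Scope ring_scope.

(** [d_ring] is the closure of the exterior derivative on the smooth compactly
    supported forms, so these forms are dense in its domain for the graph norm.
    It therefore suffices to show that each of them, [u], lies in
    [(1 + eta L_{e_3}) (Lambda^k \cap dom L_{e_3})].

    Since [e_3] is a constant coordinate field, its Lie derivative acts on the
    components of a form as the partial derivative [d_3] ([lie_e3]), and the
    equation [w + eta d_3 w = u] is a linear ordinary differential equation on
    each circle [{x} * (R/Z)]. For nonzero [eta] its periodic solution is the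
    average [w x = \int_0^1 G s * u (x - s e_3) ds] of [u] over the orbit, where
    [G s = exp (- s / eta) / (eta * (1 - exp (- 1 / eta)))]
    ([resolvent_identity]). The average commutes with all partial derivatives
    ([partial_orbit_avg]) and keeps the support inside a compact set times the
    circle, so [w] is again smooth, periodic and compactly supported
    ([form_avg_smooth_c]).

    It remains to see that [d_3 w] is [L_{e_3} w] for the operator
    [L_{e_3} = - * (L_{e_3,c})^* *] ([lie_op_smooth_c]). Pointwise,
    [< t, * w > vol = w /\ t] ([fdot_hodge]), which has constant coefficients in
    the components of [w] and [t], and [**] is the identity in dimension three
    ([hodge_hodge]). So the claim is the integration by parts
    [\int w /\ d_3 t = - \int d_3 w /\ t] ([integral_wedge_parts]), where no
    boundary terms arise because of periodicity ([integral_partial2_eq0]). *)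

(** * The Levi-Civita symbol *)

Lemma sum3 (V : nmodType) (F : 'I_3 -> V) : \sum_(i < 3) F i = F 0 + F 1 + F 2.
Proof.
rewrite !big_ord_recl big_ord0 addr0 addrA.
by congr (_ + _ + _); congr F; apply/val_inj.
Qed.

Lemma det3 (R : comNzRingType) (A : 'M[R]_3) : \det A =
  A 0 0 * (A 1 1 * A 2 2 - A 1 2 * A 2 1)
  - A 0 1 * (A 1 0 * A 2 2 - A 1 2 * A 2 0)
  + A 0 2 * (A 1 0 * A 2 1 - A 1 1 * A 2 0).
Proof.
have d2 (N : nat -> nat -> R) : \det (\matrix_(i < 2, j < 2) N i j)
    = N 0%N 0%N * N 1%N 1%N - N 0%N 1%N * N 1%N 0%N.
  rewrite (expand_det_row _ 0) !big_ord_recl big_ord0 /cofactor !det_mx11 !mxE /=.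
  rewrite /bump /= expr0 expr1 addr0 mulN1r mul1r mulrN //.
have [M ->] : exists M : nat -> nat -> R, A = \matrix_(i, j) M i j.
  exists (fun i j => A (inord i) (inord j)).
  by apply/matrixP => i j; rewrite mxE !inord_val.
rewrite (expand_det_row _ 0) !big_ord_recl big_ord0 /cofactor.
pose N (i j : nat) (p q : nat) := M (bump i p) (bump j q).
have rc (i j : 'I_3) : row' i (col' j (\matrix_(i, j) M i j)) = \matrix_(p < 2, q < 2) N i j p q.
  by apply/matrixP => p q; rewrite !mxE.
rewrite !rc !d2 !mxE /N /=.
rewrite /bump /= expr0 expr1 sqrrN expr1n; ring.
Qed.

(** Each leading principal minor, multiplied by a smaller one that is already known
    to be positive, is the value of the quadratic form at a vector of cofactors. *)
Lemma posdef3_det_gt0 (R : realFieldType) (A : 'M[R]_3) : A^T = A ->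
  (forall v : 'rV[R]_3, v != 0 -> 0 < (v *m A *m v^T) 0 0) -> 0 < \det A.
Proof.
move=> sA pA.
have s i j : A i j = A j i by rewrite -{1}sA mxE.
have q (a b c : R) : [|| a != 0, b != 0 | c != 0] ->
  0 < a * a * A 0 0 + b * b * A 1 1 + c * c * A 2 2
    + 2 * (a * b * A 0 1 + a * c * A 0 2 + b * c * A 1 2).
  move=> abc; set v : 'rV[R]_3 := \row_i (if i == 0 then a else if i == 1 then b else c).
  have v0 : v != 0.
    apply: contraTneq abc => /rowP v0.
    have := v0 0; have := v0 1; have := v0 2; rewrite !mxE /= => -> -> ->.
    by rewrite eqxx.
  have := pA v v0; rewrite mxE sum3 !mxE !sum3 !mxE /=.
  rewrite (s 1 0) (s 2 0) (s 2 1) => h; apply: lt_le_trans h _.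
  by rewrite le_eqVlt; apply/orP; left; apply/eqP; ring.
(* the three vectors below are the last columns of the adjugates of the
   leading principal submatrices *)
have A00 : 0 < A 0 0.
  by have := q 1 0 0; rewrite oner_eq0 => /(_ isT); rewrite !(mulr0, mul0r, mul1r, addr0).
have m2 : 0 < A 0 0 * A 1 1 - A 0 1 * A 0 1.
  have := q (- A 0 1) (A 0 0) 0; rewrite (gt_eqF A00) orbT => /(_ isT) h.
  by rewrite -(pmulr_rgt0 _ A00); apply: lt_le_trans h _;
     rewrite le_eqVlt; apply/orP; left; apply/eqP; ring.
have := q (A 0 1 * A 1 2 - A 1 1 * A 0 2) (A 0 1 * A 0 2 - A 0 0 * A 1 2)
  (A 0 0 * A 1 1 - A 0 1 * A 0 1).
rewrite (gt_eqF m2) !orbT => /(_ isT) h.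
rewrite -(pmulr_rgt0 _ m2) det3 (s 1 0) (s 2 0) (s 2 1).
by apply: lt_le_trans h _; rewrite le_eqVlt; apply/orP; left; apply/eqP; ring.
Qed.

(** This Vandermonde product takes the values 0, 1 and -1 on triples of elements of
    {0, 1, 2}; it turns finite sums of Levi-Civita symbols into polynomial
    identities between numerals. *)
Lemma levi3E (R : realType) (a b c : 'I_3) : levi_civita R [:: a; b; c] =
  (b%:R - a%:R) * (c%:R - a%:R) * (c%:R - b%:R) / 2.
Proof.
rewrite /levi_civita det3 !mxE /=.
by case: a => [[|[|[|//]]] ?]; case: b => [[|[|[|//]]] ?];
  case: c => [[|[|[|//]]] ?] /=; field.
Qed.

Section Levi.
Variables (R : realType) (k l : nat).
Hypothesis kl : (k + l)%N = 3%N.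
Implicit Types (I : midx k) (J : midx l).

(** In the concatenation [codom I ++ codom J] of two multi-indices with
    [k + l = 3], the p-th index of [I] stands at [posl p] and the q-th index of
    [J] at [posr q]. *)
Definition posl (p : 'I_k) : 'I_3 := inord p.
Definition posr (q : 'I_l) : 'I_3 := inord (k + q).

Lemma nth_posl I J p : nth 0 (codom I ++ codom J) (posl p) = I p.
Proof.
rewrite inordK; last by rewrite -[ltnRHS]kl (leq_trans (ltn_ord p)) ?leq_addr.
rewrite nth_cat size_codom card_ord ltn_ord codomE (nth_map p) ?size_enum_ord//.
by rewrite nth_ord_enum.
Qed.

Lemma nth_posr I J q : nth 0 (codom I ++ codom J) (posr q) = J q.
Proof.
rewrite inordK; last by rewrite -[ltnRHS]kl ltn_add2l.
rewrite nth_cat size_codom card_ord ltnNge leq_addr /= addKn.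
by rewrite codomE (nth_map q) ?size_enum_ord// nth_ord_enum.
Qed.

Lemma prod_pos (F : 'I_3 -> R) :
  \prod_i F i = (\prod_p F (posl p)) * \prod_q F (posr q).
Proof.
rewrite -[LHS](_ : \prod_(0 <= i < 3) F (inord i) = _); last first.
  by rewrite big_mkord; apply: eq_bigr => i _; rewrite inord_val.
rewrite (@big_cat_nat _ _ _ k 0 3) //=; last by rewrite -[leqRHS]kl leq_addr.
rewrite big_mkord; congr (_ * _).
rewrite -{1}[k]addn0 -[X in index_iota _ X]kl addnC [X in index_iota _ X]addnC big_addn addnK big_mkord.
by apply: eq_bigr => i _; rewrite addnC.
Qed.

Lemma levi_expand I J : levi_civita R (codom I ++ codom J) =
  \sum_(s : 'S_3) (-1) ^+ s *
    ((\prod_p (I p == s (posl p))%:R) * \prod_q (J q == s (posr q))%:R).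
Proof.
rewrite /levi_civita /determinant; apply: eq_bigr => s _; congr (_ * _).
rewrite prod_pos; congr (_ * _); apply: eq_bigr => i _; rewrite mxE.
  by rewrite nth_posl.
by rewrite nth_posr.
Qed.

(** The Levi-Civita symbol is a density: expanding it over the permutations of the
    three indices, the sums over [I] and [J] factor into the Leibniz formula for
    the determinant of the matrix with rows [I'], [J'] times [A^T]. For [A] the
    inverse metric, this is how raising indices produces the determinant that
    the volume factors of the Hodge star cancel. *)
Lemma levi_transform (A : 'M[R]_3) I' J' :
  \sum_(I : midx k) \sum_(J : midx l)
     (\prod_p A (I p) (I' p)) * (\prod_q A (J q) (J' q)) *
       levi_civita R (codom I ++ codom J)
  = \det A * levi_civita R (codom I' ++ codom J').
Proof.
have sum_delta n (f : 'I_n -> 'I_3) (K' : midx n) :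
    \sum_(K : midx n) (\prod_p A (K p) (K' p)) * (\prod_p (K p == f p)%:R)
    = \prod_p A (f p) (K' p).
  transitivity (\prod_p \sum_i A i (K' p) * (i == f p)%:R).
    by rewrite bigA_distr_bigA; apply: eq_bigr => K _; rewrite big_split.
  apply: eq_bigr => p _; rewrite (bigD1 (f p)) //= eqxx mulr1 big1 ?addr0//.
  by move=> i /negbTE ->; rewrite mulr0.
transitivity (\sum_(s : 'S_3) \sum_(I : midx k) \sum_(J : midx l)
    (\prod_p A (I p) (I' p)) * (\prod_q A (J q) (J' q)) * ((-1) ^+ s *
    ((\prod_p (I p == s (posl p))%:R) * \prod_q (J q == s (posr q))%:R))).
  rewrite [RHS]exchange_big; apply: eq_bigr => I _.
  rewrite [RHS]exchange_big; apply: eq_bigr => J _.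
  by rewrite levi_expand mulr_sumr.
transitivity (\det (\matrix_(i < 3, j < 3) (nth 0 (codom I' ++ codom J') i == j)%:R *m A^T)).
  rewrite /determinant; apply: eq_bigr => s _.
  transitivity ((-1) ^+ s * ((\prod_p A (s (posl p)) (I' p)) * \prod_q A (s (posr q)) (J' q))).
    rewrite -!sum_delta big_distrlr /= mulr_sumr; apply: eq_bigr => I _.
    rewrite mulr_sumr; apply: eq_bigr => J _.
    by rewrite mulrCA mulrACA.
  rewrite prod_pos; congr (_ * (_ * _)); apply: eq_bigr => i _; rewrite mxE.
    rewrite (bigD1 (I' i)) //= !mxE nth_posl eqxx mul1r big1 ?addr0// => j ji.
    by rewrite !mxE nth_posl eq_sym (negbTE ji) mul0r.
  rewrite (bigD1 (J' i)) //= !mxE nth_posr eqxx mul1r big1 ?addr0// => j ji.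
  by rewrite !mxE nth_posr eq_sym (negbTE ji) mul0r.
by rewrite det_mulmx det_tr mulrC.
Qed.

Lemma posr_inj : injective posr.
Proof.
move=> p q /(congr1 val); rewrite /= !inordK -?[ltnRHS]kl ?ltn_add2l//.
by move/addnI/val_inj.
Qed.

Lemma posr_neq_posl p q : posr q != posl p.
Proof.
apply/eqP => /(congr1 val) /=.
rewrite !inordK -?[ltnRHS]kl ?ltn_add2l// ?ltn_addr// => e.
by have := ltn_ord p; rewrite -e ltnNge leq_addr.
Qed.

(** Composing the summation index with the transposition of the two corresponding
    positions changes the sign of each permutation. *)
Lemma levi_tperm I J p q : p != q ->
  levi_civita R (codom I ++ codom [ffun r => J (tperm p q r)])
  = - levi_civita R (codom I ++ codom J).
Proof.
move=> pq; rewrite !levi_expand -sumrN.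
rewrite (reindex_inj (mulgI (tperm (posr p) (posr q)))) /=.
apply: eq_bigr => s _.
rewrite odd_permM odd_tperm (inj_eq posr_inj) pq signr_addb expr1 mulN1r -mulNr.
congr (_ * (_ * _)).
  by apply: eq_bigr => r _; rewrite permM tpermD// posr_neq_posl.
rewrite [RHS](reindex_inj (@perm_inj _ (tperm p q))) /=.
apply: eq_bigr => r _; rewrite ffunE permM.
by rewrite (inj_tperm _ _ _ posr_inj).
Qed.

End Levi.

(** Transpositions generate the symmetric group. *)
Lemma alternating_tperm (R : realType) k (a : midx k -> R) :
  (forall (I : midx k) p q, p != q -> a [ffun r => I (tperm p q r)] = - a I) ->
  alternating_comp a.
Proof.
move=> h I s; have [ts -> ] := prod_tpermP s.
elim: ts I => [|t ts IH] I /= => [_|/andP[tn tsn]].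
  rewrite big_nil odd_perm1 mul1r; congr a.
  by apply/ffunP => p; rewrite ffunE perm1.
rewrite big_cons odd_mul_tperm signr_addb tn expr1 mulN1r mulNr -IH//.
rewrite -(h _ t.1 t.2)//; congr a.
by apply/ffunP => p; rewrite !ffunE permM.
Qed.

Lemma sum_midx0 (R : realType) (F : seq 'I_3 -> R) :
  \sum_(I : midx 0) F (codom I) = F [::].
Proof.
rewrite (eq_bigr (fun=> F [::])); last first.
  by move=> I _; congr F; apply: size0nil; rewrite size_codom card_ord.
by rewrite sumr_const card_ffun !card_ord expn0.
Qed.

Lemma codom_ffunS k (I : midx k.+1) :
  codom I = I ord0 :: codom [ffun p => I (lift ord0 p)].
Proof.
rewrite !codomE enum_ordSl /= -map_comp; congr (_ :: _).
by apply: eq_map => p /=; rewrite ffunE.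
Qed.

Lemma sum_midxS (R : realType) k (F : seq 'I_3 -> R) :
  \sum_(I : midx k.+1) F (codom I) =
  \sum_(i < 3) \sum_(I : midx k) F (i :: codom I).
Proof.
pose h (iI : 'I_3 * midx k) : midx k.+1 :=
  [ffun p => if unlift ord0 p is Some q then iI.2 q else iI.1].
rewrite pair_big /= (reindex h) /=.
  apply: eq_bigr => -[i I] _; rewrite codom_ffunS.
  have -> : [ffun p => h (i, I) (lift ord0 p)] = I.
    by apply/ffunP => p; rewrite !ffunE liftK.
  by rewrite ffunE unlift_none.
exists (fun I => (I ord0, [ffun p => I (lift ord0 p)])) => [[i I]|I] _.
  by rewrite /h ffunE unlift_none; congr (_, _); apply/ffunP => p; rewrite !ffunE liftK.
by apply/ffunP => p; rewrite !ffunE; case: unliftP => [q|] -> //=; rewrite ffunE.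
Qed.

(** The sum over all words of length [n] on three letters, in a form that computes
    for a concrete [n]. *)
Fixpoint sumseq (R : realType) n (F : seq 'I_3 -> R) : R :=
  if n is n'.+1 then
    sumseq n' (fun s => F (0 :: s)) + sumseq n' (fun s => F (1 :: s)) +
    sumseq n' (fun s => F (2 :: s))
  else F [::].

Lemma sum_midx (R : realType) k (F : seq 'I_3 -> R) :
  \sum_(I : midx k) F (codom I) = sumseq k F.
Proof.
elim: k F => [|k IH] F; first exact: sum_midx0.
by rewrite sum_midxS sum3 /= -!IH.
Qed.

Lemma nth_codom_ord k (I : midx k) x0 (p : 'I_k) : nth x0 (codom I) p = I p.
Proof. by rewrite codomE (nth_map p) ?size_enum_ord// nth_ord_enum. Qed.

Lemma alternating_seq (R : realType) k (a : midx k -> R) :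
  exists A : seq 'I_3 -> R, forall I, a I = A (codom I).
Proof.
exists (fun s => a [ffun p : 'I_k => nth 0 s p]) => I; congr a.
by apply/ffunP => p; rewrite ffunE nth_codom_ord.
Qed.

(** The contraction of two Levi-Civita symbols that underlies [** = 1] in dimension
    three (no sign occurs, since [k * (3 - k)] is even). For each of the four
    degrees it is a finite identity, checked after all components of [a] have been
    expressed by those with increasing indices. *)
Lemma levi_contract (R : realType) k (a : midx k -> R) (I : midx k) :
  (k <= 3)%N -> alternating_comp a ->
  \sum_(J : midx (3 - k)) \sum_(K : midx k)
    a K * levi_civita R (codom K ++ codom J) * levi_civita R (codom J ++ codom I)
  = (k`!)%:R * ((3 - k)`!)%:R * a I.
Proof.
have [A aA] := alternating_seq a.
move=> k3 alt.
have {alt} alt (K : midx k) p q : p != q -> A (codom K) = - A (codom [ffun r => K (tperm p q r)]).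
  by move=> pq; rewrite -!aA alt odd_tperm pq expr1 mulN1r opprK.
rewrite aA; under eq_bigr do under eq_bigr do rewrite aA.
have e0 : (0 : 'I_3) = 0%N :> nat by [].
have e1 : (1 : 'I_3) = 1%N :> nat by [].
have e2 : (2 : 'I_3) = 2%N :> nat by [].
have codom0 (K : midx 0) : codom K = [::] by apply: size0nil; rewrite size_codom card_ord.
(* from here on [a] is replaced by the function [A] of sequences, so that the
   sums over multi-indices can be unfolded by [sumseq] *)
pose G (s J K : seq 'I_3) := A K * levi_civita R (K ++ J) * levi_civita R (J ++ s).
rewrite -[LHS]/(\sum_(J : midx (3 - k)) \sum_(K : midx k) G (codom I) (codom J) (codom K)).
have cases (P : 'I_3 -> Prop) : P 0 -> P 1 -> P 2 -> forall i, P i.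
  move=> P0 P1 P2 [[|[|[|//]]] h].
  - by rewrite (_ : Ordinal h = 0) //; apply/val_inj.
  - by rewrite (_ : Ordinal h = 1) //; apply/val_inj.
  - by rewrite (_ : Ordinal h = 2) //; apply/val_inj.
transitivity (sumseq (3 - k) (fun J => sumseq k (G (codom I) J))).
  rewrite -sum_midx; apply: eq_bigr => J _; rewrite -sum_midx; exact: eq_bigr.
have f0 : 0`! = 1%N by []. have f1 : 1`! = 1%N by [].
have f2 : 2`! = 2%N by []. have f3 : 3`! = 6%N by [].
have codom1 (K : midx 1) : codom K = [:: K ord0] by rewrite codom_ffunS codom0.
have codom2 (K : midx 2) : codom K = [:: K ord0; K ord_max].
  rewrite codom_ffunS codom1 ffunE (_ : lift ord0 ord0 = ord_max)//; exact: val_inj.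
have codom3 (K : midx 3) : codom K = [:: K 0; K 1; K 2].
  rewrite codom_ffunS codom2 !ffunE; congr [:: _; K _; K _]; exact: val_inj.
case: k k3 a I aA alt => [|[|[|[|//]]]] _ a I _ alt; rewrite ?subn0 ?subSS ?subnn.
- by rewrite codom0 /= /G /= !levi3E !e0 !e1 !e2 f0 f3; field.
- rewrite codom1 /= /G /= !levi3E !e0 !e1 !e2 f1 f2.
  by elim/cases: (I ord0); rewrite ?e0 ?e1 ?e2; field.
- have sw i j : A [:: i; j] = - A [:: j; i].
    pose K : midx 2 := [ffun p => if p == ord0 then i else j].
    by have := alt K ord0 ord_max isT; rewrite !codom2 !ffunE tpermL tpermR /=.
  have d i : A [:: i; i] = 0 by apply/eqP; rewrite -eqNr -sw.
  rewrite codom2 /= /G /= !levi3E !e0 !e1 !e2 f1 f2.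
  rewrite !d (sw 1 0) (sw 2 0) (sw 2 1).
  by elim/cases: (I ord0); elim/cases: (I ord_max); rewrite ?d ?(sw 1 0) ?(sw 2 0) ?(sw 2 1) ?e0 ?e1 ?e2; field.
- have sw1 i j l : A [:: i; j; l] = - A [:: j; i; l].
    pose K : midx 3 := [ffun p : 'I_3 => nth l [:: i; j] p].
    by have := alt K 0 1 isT; rewrite !codom3 !ffunE tpermL tpermR tpermD.
  have sw2 i j l : A [:: i; j; l] = - A [:: i; l; j].
    pose K : midx 3 := [ffun p : 'I_3 => nth l [:: i; j] p].
    by have := alt K 1 2 isT; rewrite !codom3 !ffunE tpermL tpermR tpermD.
  have d1 i l : A [:: i; i; l] = 0 by apply/eqP; rewrite -eqNr -sw1.
  have d2 i l : A [:: l; i; i] = 0 by apply/eqP; rewrite -eqNr -sw2.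
  have d3 i l : A [:: i; l; i] = 0 by rewrite sw1 d2 oppr0.
  have [c AE] : exists c, forall i j l,
      A [:: i; j; l] = levi_civita R [:: i; j; l] * c.
    exists (A [:: 0; 1; 2]) => i j l.
    by rewrite levi3E; elim/cases: i; elim/cases: j; elim/cases: l;
      rewrite ?(d1, d2, d3) ?(sw1 1 0 2) ?(sw2 0 2 1) ?(sw1 2 1 0) ?(sw2 1 2 0) ?(sw1 1 0 2)
        ?(sw1 2 0 1) ?(sw2 0 2 1) ?e0 ?e1 ?e2; field.
  rewrite codom3 /= /G /= f3 f0 !AE.
  move: (levi_civita R [:: I 0; I 1; I 2]) => z.
  by rewrite !levi3E !e0 !e1 !e2; field.
Qed.

(** * The Hodge star at a point *)

Section Pointwise.
Variables (R : realType) (Sigma : set (R * R)) (g : R * R * R -> 'M[R]_3).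
Hypothesis gP : riemannian_metric Sigma g.
Variable x : R * R * R.
Hypothesis Ox : Omega Sigma x.

Lemma det_metric_gt0 : 0 < \det (g x).
Proof. by have [_ _ sg pg] := gP; apply: posdef3_det_gt0 => [|v]; [exact: sg|exact: pg]. Qed.

Lemma ginv_sym i j : ginv g x i j = ginv g x j i.
Proof.
have [_ _ sg _] := gP.
by rewrite /ginv -{1}(sg x Ox) -trmx_inv mxE.
Qed.

Lemma vol_sqr_det_ginv : vol g x ^+ 2 * \det (ginv g x) = 1.
Proof.
have dg := det_metric_gt0.
by rewrite /vol sqr_sqrtr ?ltW// /ginv det_inv divff// gt_eqF.
Qed.

End Pointwise.

(** The coefficient of [dx^0 /\ dx^1 /\ dx^2] in [a /\ b], for forms of
    complementary degrees. *)
Definition wedge3 (R : realType) k l (a : midx k -> R) (b : midx l -> R) : R :=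
  ((k`!)%:R * (l`!)%:R)^-1 *
  \sum_(I : midx k) \sum_(J : midx l) a I * b J * levi_civita R (codom I ++ codom J).

Section Hodge.
Variables (R : realType) (Sigma : set (R * R)) (g : R * R * R -> 'M[R]_3).
Hypothesis gP : riemannian_metric Sigma g.
Variable x : R * R * R.
Hypothesis Ox : Omega Sigma x.

(** With the inverse metric applied both to [a] and to the free indices of the
    Levi-Civita symbol, [levi_transform] leaves only its determinant. *)
Lemma raise_contract k l (a : midx k -> R) (J : midx l) : (k + l = 3)%N ->
  \sum_(L : midx l) (\prod_q ginv g x (J q) (L q)) *
     \sum_(K : midx k) raise g x a K * levi_civita R (codom K ++ codom L)
  = \det (ginv g x) * \sum_(K : midx k) a K * levi_civita R (codom K ++ codom J).
Proof.
move=> kl; rewrite mulr_sumr.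
transitivity (\sum_(K' : midx k) a K' * \sum_(K : midx k) \sum_(L : midx l)
  (\prod_p ginv g x (K p) (K' p)) * (\prod_q ginv g x (L q) (J q)) *
  levi_civita R (codom K ++ codom L)).
  under [RHS]eq_bigr do (rewrite exchange_big mulr_sumr).
  rewrite [RHS]exchange_big; apply: eq_bigr => L _.
  rewrite mulr_sumr.
  under [RHS]eq_bigr do rewrite mulr_sumr.
  rewrite [RHS]exchange_big; apply: eq_bigr => K _.
  rewrite /raise mulr_suml mulr_sumr; apply: eq_bigr => K' _.
  under [X in X * _ = _]eq_bigr do rewrite (ginv_sym gP Ox).
  move: (\prod_(q < l) _) (\prod_(q < k) _) (a K') (levi_civita _ _) => p q r s.
  ring.
by apply: eq_bigr => K' _; rewrite levi_transform// mulrCA.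
Qed.

Lemma hodge_hodge k (a : kform R k) : (k <= 3)%N -> alternating_comp (a x) ->
  forall I, hodge g (l := k) (hodge g (l := 3 - k) a) x I = a x I.
Proof.
move=> k3 alt I.
have kl : (k + (3 - k) = 3)%N by rewrite subnKC.
have fn0 n : (n`!)%:R != 0 :> R by rewrite pnatr_eq0 -lt0n fact_gt0.
apply: (mulfI (fn0 k)); apply: (mulfI (fn0 (3 - k)%N)).
rewrite [in RHS]mulrCA [in RHS]mulrA -levi_contract//.
have v1 := vol_sqr_det_ginv gP Ox.
rewrite {1}/hodge.
transitivity ((k`!)%:R * vol g x *
  \sum_(J : midx (3 - k)) raise g x (hodge g (l := 3 - k) a x) J * levi_civita R (codom J ++ codom I)).
  by have := fn0 (3 - k)%N; move: (fn0 k) (\sum_(_ : _) _) => ? S ?; field.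
rewrite mulr_sumr; apply: eq_bigr => J _.
rewrite /raise /hodge.
transitivity (vol g x ^+ 2 * (\sum_(L : midx (3 - k)) (\prod_q ginv g x (J q) (L q)) *
     \sum_(K : midx k) raise g x (a x) K * levi_civita R (codom K ++ codom L))
   * levi_civita R (codom J ++ codom I)).
  rewrite !mulrA; congr (_ * _); rewrite mulr_sumr mulr_sumr; apply: eq_bigr => L _.
  move: (\prod_(_ < _) _) (\sum_(_ : _) _) => p S.
  by have := fn0 k; move=> ?; field.
by rewrite raise_contract// [vol g x ^+ 2 * _]mulrA v1 mul1r mulr_suml.
Qed.

(** The defining property of the Hodge star, [<b, *a> vol = a /\ b]. Its right-hand
    side does not involve the metric, which is why integration by parts for
    [L_{e_3}] only differentiates the components of the forms. *)
Lemma fdot_hodge k l (b : midx l -> R) (a : kform R k) : (k + l = 3)%N ->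
  fdot g x b (hodge g (l := l) a x) * vol g x = wedge3 (a x) b.
Proof.
move=> kl; have v1 := vol_sqr_det_ginv gP Ox.
have fn0 n : (n`!)%:R != 0 :> R by rewrite pnatr_eq0 -lt0n fact_gt0.
rewrite /fdot /hodge /wedge3.
transitivity (((k`!)%:R * (l`!)%:R)^-1 * (vol g x ^+ 2 *
  \sum_(L : midx l) b L * \sum_(J : midx l) (\prod_q ginv g x (L q) (J q)) *
    \sum_(K : midx k) raise g x (a x) K * levi_civita R (codom K ++ codom J))).
  transitivity (((k`!)%:R * (l`!)%:R)^-1 * (vol g x ^+ 2 *
    \sum_(J : midx l) raise g x b J *
    \sum_(K : midx k) raise g x (a x) K * levi_civita R (codom K ++ codom J))).
    rewrite !mulr_sumr mulr_suml; apply: eq_bigr => J _.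
    by move: (fn0 k) (fn0 l) (\sum_(_ : _) _) (raise _ _ _ _) => ? ? S T; field; apply/andP.
  congr (_ * (_ * _)).
  under [RHS]eq_bigr do rewrite mulr_sumr.
  rewrite [RHS]exchange_big; apply: eq_bigr => J _.
  rewrite /raise mulr_suml; apply: eq_bigr => L _.
  rewrite (eq_bigr (fun q => ginv g x (L q) (J q))); last first.
    by move=> q _; rewrite (ginv_sym gP Ox).
  by rewrite mulrA [b L * _]mulrC.
congr (_ * _).
rewrite [RHS]exchange_big mulr_sumr; apply: eq_bigr => L _.
rewrite raise_contract// mulrCA [_ ^+ 2 * _]mulrA v1 mul1r mulr_sumr.
by apply: eq_bigr => K _; rewrite mulrCA mulrA.
Qed.

Lemma hodge_alternating k l (a : kform R k) : (k + l = 3)%N ->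
  alternating_comp (hodge g (l := l) a x).
Proof.
move=> kl; apply: alternating_tperm => J p q pq.
rewrite /hodge -mulrN -sumrN; congr (_ * _); apply: eq_bigr => I _.
by rewrite levi_tperm// mulrN.
Qed.

End Hodge.

(** * Continuous functions on the cover *)

Section ContinuousOn.
Variables (R : realType).
Local Notation pt := (R * R * R)%type.

Definition cont_on (U : set pt) (f : pt -> R) :=
  forall x, U x -> {for x, continuous f}.

Variable U : set pt.

Lemma cont_on_cst c : cont_on U (fun=> c).
Proof. by move=> x _; exact: cvg_cst. Qed.

Lemma cont_onD f h : cont_on U f -> cont_on U h -> cont_on U (fun x => f x + h x).
Proof. by move=> cf ch x Ux; apply: cvgD; [exact: cf|exact: ch]. Qed.

Lemma cont_onM f h : cont_on U f -> cont_on U h -> cont_on U (fun x => f x * h x).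
Proof. by move=> cf ch x Ux; apply: cvgM; [exact: cf|exact: ch]. Qed.

(** Values outside the open set [U] do not matter; this is needed because, for
    instance, the cofactor formula for [invmx] holds only where the metric is
    invertible. *)
Lemma cont_on_eq f h : open U -> (forall x, U x -> f x = h x) ->
  cont_on U f -> cont_on U h.
Proof.
move=> oU fh cf x Ux; rewrite /prop_for /continuous_at -(fh x Ux).
apply: cvg_trans (cf x Ux); apply: near_eq_cvg.
have Un : nbhs x U by exact: open_nbhs_nbhs.
by near=> y; apply: fh; near: y.
Unshelve. all: by end_near. Qed.

Lemma cont_on_sum (I : Type) (s : seq I) (P : pred I) (F : I -> pt -> R) :
  (forall i, P i -> cont_on U (F i)) ->
  cont_on U (fun x => \sum_(i <- s | P i) F i x).
Proof.
move=> cF; elim: s => [|i s IH].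
  by under eq_fun do rewrite big_nil; exact: cont_on_cst.
have [Pi|/negbTE Pi] := boolP (P i); under eq_fun do rewrite big_cons Pi; last by [].
by apply: cont_onD => //; exact: cF.
Qed.

Lemma cont_on_prod (I : Type) (s : seq I) (P : pred I) (F : I -> pt -> R) :
  (forall i, P i -> cont_on U (F i)) ->
  cont_on U (fun x => \prod_(i <- s | P i) F i x).
Proof.
move=> cF; elim: s => [|i s IH].
  by under eq_fun do rewrite big_nil; exact: cont_on_cst.
have [Pi|/negbTE Pi] := boolP (P i); under eq_fun do rewrite big_cons Pi; last by [].
by apply: cont_onM => //; exact: cF.
Qed.

Lemma cont_on_det n (M : pt -> 'M[R]_n) :
  (forall i j, cont_on U (fun x => M x i j)) -> cont_on U (fun x => \det (M x)).
Proof.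
move=> cM; apply: cont_on_sum => s _; apply: cont_onM; first exact: cont_on_cst.
by apply: cont_on_prod => i _; exact: cM.
Qed.

Lemma cont_onV f : (forall x, U x -> f x != 0) -> cont_on U f ->
  cont_on U (fun x => (f x)^-1).
Proof. by move=> f0 cf x Ux; apply: cvgV; [exact: f0|exact: cf]. Qed.

Lemma cont_on_sqrt f : cont_on U f -> cont_on U (fun x => Num.sqrt (f x)).
Proof.
move=> cf x Ux; apply: (@continuous_comp _ _ _ f Num.sqrt); first exact: cf.
exact: sqrt_continuous.
Qed.

End ContinuousOn.

Lemma open_Omega (R : realType) (Sigma : set (R * R)) :
  open Sigma -> open (Omega Sigma).
Proof.
move=> oS; rewrite (_ : Omega Sigma = fst @^-1` Sigma).
  by apply: open_comp => // x _; exact: cvg_fst.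
by apply/seteqP; split => [x []|x]//; split.
Qed.

Lemma smooth_cont_on (R : realType) (U : set (R * R * R)) f s :
  smooth_on U f -> cont_on U (foldr (@partial R) f s).
Proof. by move=> sf x Ux; have [] := sf s x Ux. Qed.

Section MetricContinuity.
Variables (R : realType) (Sigma : set (R * R)) (g : R * R * R -> 'M[R]_3).
Hypothesis oS : open Sigma.
Hypothesis gP : riemannian_metric Sigma g.
Let oO := open_Omega oS.
Local Notation cont := (cont_on (Omega Sigma)).

Lemma cont_metric i j : cont (fun x => g x i j).
Proof. by have [sg _ _ _] := gP; exact: (@smooth_cont_on _ _ _ [::]). Qed.

Lemma cont_vol : cont (vol g).
Proof. by apply: cont_on_sqrt; apply: cont_on_det => i j; exact: cont_metric. Qed.

Lemma cont_ginv i j : cont (fun x => ginv g x i j).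
Proof.
apply: (@cont_on_eq _ _ (fun x => (\det (g x))^-1 * \adj (g x) i j)) => //.
  move=> x Ox; rewrite /ginv /invmx unitmxE unitfE gt_eqF ?mxE//.
  exact: det_metric_gt0 Ox.
apply: cont_onM.
  apply: cont_onV => [x Ox|]; first by rewrite gt_eqF// (det_metric_gt0 gP Ox).
  by apply: cont_on_det => ? ?; exact: cont_metric.
under eq_fun do rewrite mxE.
apply: cont_onM; first exact: cont_on_cst.
apply: cont_on_det => p q; under eq_fun do rewrite !mxE.
exact: cont_metric.
Qed.

Lemma cont_raise k (a : kform R k) I : (forall J, cont (a^~ J)) ->
  cont (fun x => raise g x (a x) I).
Proof.
move=> ca; apply: cont_on_sum => J _; apply: cont_onM => //.
by apply: cont_on_prod => p _; exact: cont_ginv.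
Qed.

Lemma cont_fdot k (a b : kform R k) :
  (forall J, cont (a^~ J)) -> (forall J, cont (b^~ J)) ->
  cont (fun x => fdot g x (a x) (b x)).
Proof.
move=> ca cb; apply: cont_onM; first exact: cont_on_cst.
by apply: cont_on_sum => J _; apply: cont_onM => //; exact: cont_raise.
Qed.

Lemma cont_hodge k l (a : kform R k) : (forall J, cont (a^~ J)) ->
  forall J, cont ((hodge g (l := l) a)^~ J).
Proof.
move=> ca J; apply: cont_onM.
  by apply: cont_onM; [exact: cont_on_cst|exact: cont_vol].
apply: cont_on_sum => I _; apply: cont_onM; first exact: cont_raise.
exact: cont_on_cst.
Qed.

End MetricContinuity.

(** * Square integrability of continuous forms with compact support *)

Section Measurability.
Variable R : realType.
Local Notation pt := (R * R * R)%type.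
Local Notation mpt :=
  (measurableTypeR R * measurableTypeR R * measurableTypeR R)%type.

Definition ratbox (q : (rat * rat) * (rat * rat) * (rat * rat)) : set pt :=
  (`]ratr q.1.1.1, ratr q.1.1.2[ `*` `]ratr q.1.2.1, ratr q.1.2.2[)
  `*` `]ratr q.2.1, ratr q.2.2[.

(** Boxes with rational endpoints form a countable base of the topology; hence
    open sets are measurable for the product of the Borel sigma-algebras. *)
Lemma open_ratbox (V : set pt) : open V ->
  V = \bigcup_q (if `[< ratbox q `<=` V >] then ratbox q else set0).
Proof.
move=> oV; apply/seteqP; split => [x Vx|x [q _]]; last by case: asboolP => // /(_ x).
have /nbhs_ballP[e /= e0 eV] : nbhs x V by exact: open_nbhs_nbhs.
have rat_around (c : R) : exists q : rat * rat,
    (c \in `]ratr q.1, ratr q.2[) /\ (`]ratr q.1, ratr q.2[ `<=` ball c e).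
  have [|a] := @rat_in_itvoo _ (c - e) c; first by rewrite gtrBl.
  have [|b] := @rat_in_itvoo _ c (c + e); first by rewrite ltrDl.
  rewrite !in_itv /= => /andP[cb be] /andP[ea ac].
  exists (a, b); rewrite in_itv /= ac cb; split => // y /=.
  rewrite in_itv /= /ball /= => /andP[ay yb]; rewrite ltr_distlC.
  by rewrite (lt_trans ea ay) (lt_trans yb be).
have [q1 [xq1 q1e]] := rat_around x.1.1.
have [q2 [xq2 q2e]] := rat_around x.1.2.
have [q3 [xq3 q3e]] := rat_around x.2.
exists (q1, q2, q3) => //; case: asboolP => [_|]; first by [].
case=> y [[/= y1 y2] y3]; apply: eV.
by split; [split; [exact: q1e|exact: q2e]|exact: q3e].
Qed.

Lemma open_measurable3 (V : set pt) : open V -> measurable (V : set mpt).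
Proof.
move=> /open_ratbox ->; apply: countable_bigcupT_measurable => // q.
case: ifP => // _.
by apply: measurableX; [apply: measurableX|]; exact: measurable_itv.
Qed.

Lemma cont_on_measurable (U : set pt) (D : set mpt) (f : pt -> R) :
  open U -> measurable D -> D `<=` U -> cont_on U f ->
  measurable_fun D (fun x : mpt => f x : R).
Proof.
move=> oU mD DU cf; apply: (measurability _ (RGenOpens.measurableE R)).
move=> _ [_ [a [b ->] <-]].
have -> : D `&` f @^-1` `]a, b[ = D `&` (U `&` f @^-1` `]a, b[).
  by apply/seteqP; split => x [Dx]; [move=> fx; do 2?split => //; exact: DU|case].
apply: measurableI => //; apply: (@open_measurable3 (U `&` f @^-1` `]a, b[)).
rewrite openE => x [Ux fx]; rewrite /interior; apply: filterI.
  exact: open_nbhs_nbhs.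
by apply: (cf x Ux); apply: open_nbhs_nbhs; split => //; exact: interval_open.
Qed.

Variable Sigma : set (R * R).
Hypothesis oS : open Sigma.

Lemma cell_Omega x : cell Sigma x -> Omega Sigma x.
Proof. by case. Qed.

Lemma open_cell : open (cell Sigma).
Proof.
rewrite (_ : cell Sigma = Omega Sigma `&` snd @^-1` `]- 2^-1, 2^-1[).
  apply: openI; first exact: open_Omega.
  by apply: open_comp; [move=> x _; exact: cvg_snd|exact: interval_open].
by apply/seteqP; split => [x []|x [[]]].
Qed.

Lemma measurable_cell : measurable (cell Sigma : set mpt).
Proof. by apply: open_measurable3; exact: open_cell. Qed.

Definition csupp_on (f : pt -> R) := supp_compact Sigma (fun x => f x = 0).

(** The function is bounded on the cell, because its support meets the closed cell
    in a compact set, and it vanishes outside a bounded box. *)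
Lemma cont_csupp_integrable (f : pt -> R) :
  cont_on (Omega Sigma) f -> csupp_on f ->
  (@leb3 R).-integrable (cell Sigma) (EFin \o f).
Proof.
move=> cf [K [cK KS f0]].
have [C [C0 fC]] : exists C : R, 0 <= C /\ forall x, cell Sigma x -> `|f x| <= C.
  have cKI : compact (K `*` `[(- 2^-1 : R), 2^-1]).
    by apply: compact_setX => //; exact: segment_compact.
  have : compact (f @` (K `*` `[(- 2^-1 : R), 2^-1])).
    apply: continuous_compact cKI; apply: continuous_in_subspaceT => x.
    by rewrite inE => -[Kx _]; apply: cf; split => //; exact: KS.
  move=> /compact_bounded[M [Mr bM]]; exists (`|M| + 1); split => // x [Sx xI].
  have [Kx|nKx] := pselect (K x.1); last by rewrite f0// normr0.
  apply: bM; first by rewrite ltr_pwDr// ler_norm.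
  by exists x => //; split => //; exact: subset_itv_oo_cc.
have [M KM] : exists M : R, forall x, K x -> `|x.1| <= M /\ `|x.2| <= M.
  have [M [Mr bM]] := compact_bounded cK; exists (`|M| + 1) => x Kx.
  have := bM (`|M| + 1); rewrite ltr_pwDr ?ler_norm// => /(_ isT x Kx).
  by rewrite /= prod_normE ge_max => /andP[].
pose B : set mpt := (`[- M, M] `*` `[- M, M]) `*` `[(- 2^-1 : R), 2^-1].
have mB : measurable B by apply: measurableX; [apply: measurableX|]; exact: measurable_itv.
have mc := measurable_cell.
apply: (@eq_integrable _ _ _ _ _ mc ((EFin \o f) \_ B)).
  move=> x; rewrite inE => -[Sx xI]; rewrite patchE; case: ifPn => //.
  rewrite notin_setE => nB /=; rewrite f0// => Kx; apply: nB.
  have [x1 x2] := KM _ Kx; split; last exact: subset_itv_oo_cc.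
  by split; rewrite /= in_itv /= -ler_norml.
apply/(integrable_restrict _ mB mc).
apply: measurable_bounded_integrable.
- exact: measurableI.
- apply: (@le_lt_trans _ _ (leb3 R B)).
    by apply: le_measure; rewrite ?inE//; exact: measurableI.
  have mI (a b : R) : measurable (`[a, b] : set (measurableTypeR R)).
    exact: measurable_itv.
  pose IM : set (measurableTypeR R) := [set` `[- M, M]].
  pose I1 : set (measurableTypeR R) := [set` `[- 2^-1, 2^-1]].
  have -> : leb3 R B =
      (lebesgue_measure IM * lebesgue_measure IM * lebesgue_measure I1)%E.
    rewrite -(product_measure1E lebesgue_measure lebesgue_measure (mI _ _) (mI _ _)).
    by apply: product_measure1E; [apply: measurableX|]; exact: mI.
  have IMoo : (lebesgue_measure IM < +oo)%E.
    exact/compact_finite_measure/segment_compact.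
  have I1oo : (lebesgue_measure I1 < +oo)%E.
    exact/compact_finite_measure/segment_compact.
  have IMfin : (lebesgue_measure IM \is a fin_num)%E by rewrite ge0_fin_numE.
  by apply: lte_mul_pinfty => //; [exact: mule_ge0|exact: fin_numM].
- apply: (cont_on_measurable (open_Omega oS)) => //; first exact: measurableI.
  by move=> x [] /cell_Omega.
- exists C; split => //; first by rewrite num_real.
  by move=> M' CM x [/fC fx _]; rewrite /= (le_trans fx)// ltW.
Qed.

Lemma L2form_cont_csupp g k (a : kform R k) : riemannian_metric Sigma g ->
  (forall I, cont_on (Omega Sigma) (a^~ I)) ->
  (forall x, Omega Sigma x -> alternating_comp (a x)) ->
  supp_compact Sigma (fun x => a x = fun=> 0) ->
  L2form Sigma g a.
Proof.
move=> gP ca alt [K [cK KS a0]]; split.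
- move=> I; apply: (cont_on_measurable (open_Omega oS)); last exact: ca.
    exact: measurable_cell.
  exact: cell_Omega.
- by move=> x /cell_Omega /alt.
- apply: integrable_lty; first exact: measurable_cell.
  apply: cont_csupp_integrable.
    by apply: cont_onM; [exact: cont_fdot|exact: cont_vol].
  exists K; split => // x Ox nKx; rewrite /fdot big1 ?mulr0 ?mul0r// => I _.
  by rewrite (a0 x Ox nKx) mulr0.
Qed.

End Measurability.

(** * Integrals of derivatives along the orbits of e_3 *)

Section Leb2.
Variable R : realType.
Local Notation R2 := (measurableTypeR R * measurableTypeR R)%type.
(** The base measure of [leb3], with a name that carries the sigma-finite structure
    required by Fubini's theorem. *)
Definition leb2f : set R2 -> \bar R := (@lebesgue_measure R \x @lebesgue_measure R)%E.
HB.instance Definition _ := Measure.copy leb2f (@lebesgue_measure R \x @lebesgue_measure R)%E.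
Lemma leb2f_sigma_finite : sigma_finite setT leb2f.
Proof.
have /sigma_finiteP[F [TF ndF Foo]] := sigma_finiteT (@lebesgue_measure R).
exists (fun n => F n `*` F n).
  rewrite -setXTT TF predeqE => -[x y]; split.
    move=> [/= [n _ Fnx] [k _ Fky]]; exists (maxn n k) => //; split.
    - by move: x Fnx; exact/subsetPset/ndF/leq_maxl.
    - by move: y Fky; exact/subsetPset/ndF/leq_maxr.
  by move=> [n _ []/= ? ?]; split; exists n.
move=> k; have [mF Ffin] := Foo k.
split; first exact: measurableX.
have -> : leb2f (F k `*` F k) = (lebesgue_measure (F k) * lebesgue_measure (F k))%E.
  exact: product_measure1E.
by rewrite lte_mul_pinfty// ge0_fin_numE.
Qed.
HB.instance Definition _ := Measure_isSigmaFinite.Build _ _ _ leb2f leb2f_sigma_finite.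
Definition leb2 : {sigma_finite_measure set R2 -> \bar R} := leb2f.

Lemma leb3E : leb3 R = (leb2 \x (@lebesgue_measure R))%E.
Proof. reflexivity. Qed.
End Leb2.

Section Lines.
Variable R : realType.
Local Notation pt := (R * R * R)%type.

(** The difference quotients of [f] in direction [v] and those of the restriction of
    [f] to the line are the same functions of the increment. *)
Lemma derive_line (f : pt -> R) (v x : pt) (r : R) :
  (derivable (fun h : R => f (h *: v + x)) r 1 = derivable f (r *: v + x) v) *
  ('D_1 (fun h : R => f (h *: v + x)) r = 'D_v f (r *: v + x)).
Proof.
have e : (fun h : R => h^-1 *: (f ((h *: 1 + r) *: v + x) - f (r *: v + x))) =
         (fun h : R => h^-1 *: (f (h *: v + (r *: v + x)) - f (r *: v + x))).
  apply/funext => h; congr (_ *: (f _ - _)).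
  by rewrite scalerDl addrA [h *: 1]mulr1.
by split; [rewrite /derivable e|rewrite /derive e].
Qed.

Lemma is_derive_line (f : pt -> R) (v x : pt) (r : R) :
  derivable f (r *: v + x) v ->
  is_derive r 1 (fun h : R => f (h *: v + x)) ('D_v f (r *: v + x)).
Proof.
move=> df; apply: DeriveDef; last by rewrite (derive_line f v x r).2.
by rewrite (derive_line f v x r).1.
Qed.

Lemma ebase2 (x : R * R) (r c : R) : r *: ebase R 2 + (x, c) = (x, c + r) :> pt.
Proof.
case: x => a b; rewrite /ebase /=; congr (_, _, _) => /=.
- by rewrite [_ *: _]mulr0 add0r.
- by rewrite [_ *: _]mulr0 add0r.
- by rewrite [_ *: _]mulr1 addrC.
Qed.

Lemma FTC2_is_derive (F f : R -> R) (a b : R) : a < b ->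
  (forall r : R, is_derive r (1 : R) F (f r)) -> continuous f ->
  (\int[lebesgue_measure]_(r in `[a, b]) (f r)%:E = (F b)%:E - (F a)%:E)%E.
Proof.
move=> ab dF cf.
have cF : continuous F.
  by move=> r; apply: differentiable_continuous; apply/derivable1_diffP; case: (dF r).
apply: continuous_FTC2 => //.
- exact: continuous_subspaceT.
- split.
  + by move=> r _; case: (dF r).
  + by apply: cvg_at_right_filter; exact: cF.
  + by apply: cvg_at_left_filter; exact: cF.
- by move=> r _; rewrite derive1E; case: (dF r).
Qed.

Lemma partial_eq (U : set pt) i (f h : pt -> R) : open U ->
  (forall x, U x -> f x = h x) -> forall x, U x -> partial i f x = partial i h x.
Proof.
move=> oU fh x Ux; apply: near_eq_derive.
have Un : nbhs x U by exact: open_nbhs_nbhs.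
by near=> y; apply: fh; near: y.
Unshelve. all: by end_near. Qed.

Lemma derivable_eq (U : set pt) (v : pt) (f h : pt -> R) : open U ->
  (forall x, U x -> f x = h x) -> forall x, U x ->
  derivable f x v -> derivable h x v.
Proof.
move=> oU fh x Ux; apply: near_eq_derivable.
have Un : nbhs x U by exact: open_nbhs_nbhs.
by near=> y; apply: fh; near: y.
Unshelve. all: by end_near. Qed.

Variable Sigma : set (R * R).
Hypothesis oS : open Sigma.

Lemma cont_line (f : pt -> R) (x : R * R) : cont_on (Omega Sigma) f -> Sigma x ->
  continuous (fun r => f (x, r)).
Proof.
move=> cf Sx r; apply: (@continuous_comp _ _ _ (fun r : R => (x, r)) f).
  exact: (cvg_pair (cvg_cst x (F := nbhs r)) (@cvg_id _ (nbhs r))).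
exact: (cf (x, r) (conj Sx I)).
Qed.

(** The complement of a compact set is open, so [f] vanishes near each point of
    it. *)
Lemma partial_off_compact (K : set (R * R)) i f : compact K ->
  (forall x, Omega Sigma x -> ~ K x.1 -> f x = 0) ->
  forall x, Omega Sigma x -> ~ K x.1 -> partial i f x = 0.
Proof.
move=> cK f0 x Ox nKx.
have clK : closed K by apply: compact_closed => //; exact: norm_hausdorff.
pose U := Omega Sigma `&` fst @^-1` (~` K).
have oU : open U.
  apply: openI; first exact: open_Omega.
  by apply: open_comp; [move=> y _; exact: cvg_fst|exact: closed_openC].
rewrite (@partial_eq U i f (cst 0))//; first exact: derive_cst.
by move=> y [Oy nKy]; exact: f0.
Qed.

Lemma csupp_partial i f : csupp_on Sigma f -> csupp_on Sigma (partial i f).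
Proof.
move=> [K [cK KS f0]]; exists K; split => //.
exact: partial_off_compact.
Qed.

(** By Fubini and the fundamental theorem of calculus the inner integral is
    [p (x, 1/2) - p (x, - 1/2)], which vanishes by periodicity. *)
Lemma integral_partial2_eq0 (p : pt -> R) :
  (forall x, Omega Sigma x -> derivable p x (ebase R 2)) ->
  cont_on (Omega Sigma) (partial 2 p) ->
  periodic3 Sigma p -> csupp_on Sigma p ->
  Rintegral (@leb3 R) (cell Sigma) (partial 2 p) = 0.
Proof.
move=> dp cq perp sp.
have iq := cont_csupp_integrable oS cq (csupp_partial 2 sp).
have mc := measurable_cell oS.
rewrite /Rintegral integral_mkcond.
have iq' : (leb3 R).-integrable setT ((EFin \o partial 2 p) \_ (cell Sigma)).
  by apply/(integrable_restrict _ mc measurableT); rewrite setTI.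
move: iq'; rewrite leb3E => iq'; rewrite -(integral12_prod_meas1 iq').
rewrite integral0_eq// => x _; rewrite /fubini_F.
have [Sx|nSx] := pselect (Sigma x); last first.
  rewrite integral0_eq// => y _; rewrite patchE memNset// => -[]//.
have h12 : - 2^-1 < 2^-1 :> R by lra.
have dl r : is_derive r (1 : R) (fun r => p (x, r)) (partial 2 p (x, r)).
  have -> : (fun r => p (x, r)) = (fun r => p (r *: ebase R 2 + (x, 0))).
    by apply/funext => t; rewrite ebase2 add0r.
  have -> : (x, r) = r *: ebase R 2 + (x, 0) by rewrite ebase2 add0r.
  by apply: is_derive_line; apply: dp; rewrite ebase2; split.
have cl := cont_line cq Sx.
pose J : set R := [set` `]- 2^-1, 2^-1[].
transitivity (\int[lebesgue_measure]_(y in J) (partial 2 p (x, y))%:E)%E.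
  rewrite [RHS]integral_mkcond; apply: eq_integral => y _.
  rewrite !patchE; congr (if _ then _ else _).
  by apply/idP/idP; rewrite !inE => //; case.
have ml (A : set R) : measurable A -> measurable_fun A (fun y => (partial 2 p (x, y))%:E).
  move=> mA; apply/measurable_EFinP; apply: measurable_funS measurableT _ _ => //.
  exact: continuous_measurable_fun.
rewrite integral_itv_obnd_cbnd; last by apply: ml; exact: measurable_itv.
rewrite integral_itv_bndo_bndc; last by apply: ml; exact: measurable_itv.
rewrite (FTC2_is_derive h12 dl cl).
have -> : p (x, 2^-1) = p (x, - 2^-1).
  have := perp (x, - 2^-1) (conj Sx I); rewrite /= => <-; congr p; congr pair; lra.
by rewrite subee.
Qed.

End Lines.

(** * Derivatives of forms *)

Section Forms.
Variable R : realType.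
Local Notation pt := (R * R * R)%type.

Definition partial_form i k (a : kform R k) : kform R k :=
  fun x I => partial i (a^~ I) x.

(** The vector field [e_3] has constant coordinates, so the terms of the Lie
    derivative that differentiate it vanish. *)
Lemma lie_e3 k (a : kform R k) : lie (@e3 R) a = partial_form 2 a.
Proof.
apply/funext => x; apply/funext => I; rewrite /lie /partial_form.
rewrite [X in _ + X]big1 ?addr0 => [|p _]; last first.
  rewrite big1// => m _.
  by rewrite [partial _ _ _]derive_cst mul0r.
have e3E m : @e3 R x 0 m = (m == 2)%:R by rewrite /e3 mxE eqxx.
rewrite (bigD1 2) //= e3E eqxx mul1r big1 ?addr0// => m /negbTE m2.
by rewrite e3E m2 mul0r.
Qed.

Lemma is_derive_sumF (I : Type) (s : seq I) (F : I -> pt -> R) dF (x v : pt) :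
  (forall i, is_derive x v (F i) (dF i)) ->
  is_derive x v (fun y => \sum_(i <- s) F i y) (\sum_(i <- s) dF i).
Proof.
move=> dFi; elim: s => [|i s IH].
  by under eq_fun do rewrite big_nil; rewrite big_nil; exact: is_derive_cst.
by under eq_fun do rewrite big_cons; rewrite big_cons; exact: is_deriveD.
Qed.

Variable Sigma : set (R * R).
Hypothesis oS : open Sigma.
Let oO := open_Omega oS.

(** Membership in [L_2] asks for no more regularity than this, and continuity of the
    metric coefficients suffices to pass it on to Hodge stars. *)
Definition cont_form_c k (a : kform R k) :=
  [/\ forall I, cont_on (Omega Sigma) (a^~ I),
      forall x, Omega Sigma x -> alternating_comp (a x) &
      supp_compact Sigma (fun x => a x = fun=> 0)].

Lemma smooth_cont_form_c k (a : kform R k) :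
  smooth_form_c Sigma a -> cont_form_c a.
Proof.
move=> [[sa _ alt] supp]; split => // I.
exact: (@smooth_cont_on _ _ _ [::]).
Qed.

Lemma derivable_smooth (f : pt -> R) i x : smooth_on (Omega Sigma) f ->
  Omega Sigma x -> derivable f x (ebase R i).
Proof. by move=> sf Ox; have [_] := sf [::] x Ox; apply. Qed.

Lemma smooth_on_partial i (f : pt -> R) : smooth_on (Omega Sigma) f ->
  smooth_on (Omega Sigma) (partial i f).
Proof. by move=> sf s x Ox; have := sf (rcons s i) x Ox; rewrite foldr_rcons. Qed.

Lemma partialZ i c (f h : pt -> R) : (forall x, Omega Sigma x -> f x = c * h x) ->
  (forall x, Omega Sigma x -> derivable h x (ebase R i)) ->
  forall x, Omega Sigma x -> partial i f x = c * partial i h x.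
Proof.
move=> fh dh x Ox; rewrite (partial_eq i oO fh Ox).
by rewrite /partial -[RHS](deriveZ _ (dh x Ox)).
Qed.

Lemma periodic_partial i (f : pt -> R) : periodic3 Sigma f ->
  periodic3 Sigma (partial i f).
Proof.
move=> perf x Ox.
have e : forall y, Omega Sigma y -> f ((0, 1) + y) = f y.
  by move=> [y1 y2] Oy; rewrite -[in RHS]perf//=; congr f; congr pair; rewrite ?add0r// addrC.
rewrite -(partial_eq i oO e Ox).
have -> : (x.1, x.2 + 1) = (0, 1) + x :> pt.
  by case: x {Ox} => a b; congr pair; rewrite ?add0r// addrC.
rewrite /partial /derive.
rewrite [in LHS](_ : (fun h => _) = (fun h : R =>
  h^-1 *: (f ((0, 1) + (h *: ebase R i + x)) - f ((0, 1) + x))))//.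
by apply/funext => h; rewrite /= addrCA.
Qed.

Lemma partial_form_smooth_c i k (a : kform R k) : smooth_form_c Sigma a ->
  smooth_form_c Sigma (partial_form i a).
Proof.
move=> [[sa pa alt] [K [cK KS a0]]]; split; first split.
- by move=> I; exact: smooth_on_partial.
- move=> x Ox; apply/funext => I.
  by apply: (periodic_partial i (f := a^~ I)) => // y Oy; rewrite pa.
- move=> x Ox I s; apply: partialZ Ox.
    by move=> y Oy; exact: alt.
  by move=> y; exact: derivable_smooth.
- exists K; split => // x Ox nKx; apply/funext => I.
  by rewrite /partial_form (partial_off_compact oS _ cK)// => y Oy nKy; rewrite a0.
Qed.

(** Deleting [j] from the domain and [s j] from the range leaves the permutation
    [t]. *)
Lemma lift_perm_ex n (s : 'S_n.+1) j : exists t : 'S_n, s = lift_perm j (s j) t.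
Proof.
have ex p : exists q, s (lift j p) = lift (s j) q.
  have : s j != s (lift j p) by rewrite (inj_eq perm_inj) neq_lift.
  by case/unlift_some => q -> _; exists q.
pose t p := projT1 (cid (ex p)).
have tE p : s (lift j p) = lift (s j) (t p) by rewrite /t; case: cid.
have tinj : injective t.
  by move=> p q e; apply: (@lift_inj _ j); apply: (@perm_inj _ s); rewrite !tE e.
exists (perm tinj); apply/permP => q.
case: (unliftP j q) => [p|] ->; last by rewrite lift_perm_id.
by rewrite lift_perm_lift permE tE.
Qed.

(** The term with index [j] of the permuted form is the term with index [s j] of the
    original one, up to the sign of the permutation induced on the remaining
    indices; [odd_lift_perm] compares the signs. *)
Lemma dform_alternating k (a : kform R k) x : smooth_form Sigma a ->
  Omega Sigma x -> alternating_comp (dform a x).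
Proof.
move=> [sa _ alt] Ox I s; rewrite /dform mulr_sumr.
rewrite [RHS](reindex_inj (@perm_inj _ s)) /=; apply: eq_bigr => j _.
have [t st] := lift_perm_ex s j.
have stj p : s (lift j p) = lift (s j) (t p) by rewrite [in LHS]st lift_perm_lift.
rewrite ffunE (@partialZ (I (s j)) ((-1) ^+ t) _ (fun y => a y [ffun p => I (lift (s j) p)])) //.
- rewrite !mulrA; congr (_ * _).
  rewrite [in (-1) ^+ nat_of_bool s]st odd_lift_perm 2!signr_addb 2!signr_odd.
  have : (-1) ^+ s j * (-1) ^+ s j = 1 :> R by rewrite -expr2 sqrr_sign.
  move: (_ ^+ s j) (_ ^+ j) (_ ^+ t) => c u v cc.
  by rewrite -[LHS]mulr1 -cc; ring.
- move=> y Oy; rewrite -alt//; congr a.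
  by apply/ffunP => p; rewrite !ffunE stj.
- by move=> y; exact: derivable_smooth.
Qed.

Lemma dform_cont_c k (a : kform R k) : smooth_form_c Sigma a ->
  cont_form_c (dform a).
Proof.
move=> [sfa [K [cK KS a0]]]; have [sa _ _] := sfa; split.
- move=> I; apply: cont_on_sum => j _; apply: cont_onM; first exact: cont_on_cst.
  exact: (@smooth_cont_on _ _ _ [:: _]).
- by move=> x; exact: dform_alternating.
- exists K; split => // x Ox nKx; apply/funext => I; rewrite /dform big1// => j _.
  rewrite (partial_off_compact oS _ cK) ?mulr0// => y Oy nKy; rewrite a0//.
Qed.

End Forms.

(** * The operator L_{e_3} on smooth forms with compact support *)

Section LieOp.
Variables (R : realType) (Sigma : set (R * R)) (g : R * R * R -> 'M[R]_3).
Hypothesis oS : open Sigma.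
Hypothesis gP : riemannian_metric Sigma g.
Local Notation pt := (R * R * R)%type.

Lemma hodge_cont_c k l (a : kform R k) : (k + l = 3)%N ->
  cont_form_c Sigma a -> cont_form_c Sigma (hodge g (l := l) a).
Proof.
move=> kl [ca alt [K [cK KS a0]]]; split.
- exact: cont_hodge.
- by move=> x Ox; apply: hodge_alternating.
- exists K; split => // x Ox nKx; apply/funext => J.
  rewrite /hodge a0// big1 ?mulr0// => I _.
  by rewrite /raise big1 ?mul0r// => L _; rewrite mulr0.
Qed.

Lemma opp_cont_c k (a : kform R k) : cont_form_c Sigma a ->
  cont_form_c Sigma (fun x I => - a x I).
Proof.
move=> [ca alt [K [cK KS a0]]]; split.
- by move=> I x Ox; apply: cvgN; exact: ca.
- by move=> x Ox I s; rewrite alt// mulrN.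
- by exists K; split => // x Ox nKx; apply/funext => J; rewrite a0// oppr0.
Qed.

Lemma L2form_cont_c k (a : kform R k) : cont_form_c Sigma a -> L2form Sigma g a.
Proof. by move=> [ca alt sa]; exact: L2form_cont_csupp. Qed.

Lemma hodgeN k l (a : kform R k) x J :
  hodge g (l := l) (fun x I => - a x I) x J = - hodge g (l := l) a x J.
Proof.
rewrite /hodge -mulrN -sumrN; congr (_ * _); apply: eq_bigr => I _.
rewrite -mulNr; congr (_ * _); rewrite /raise -sumrN.
by apply: eq_bigr => L _; rewrite mulrN.
Qed.

Lemma fdotN k x (a b : midx k -> R) : fdot g x a (fun I => - b I) = - fdot g x a b.
Proof.
rewrite /fdot -mulrN -sumrN; congr (_ * _).
by apply: eq_bigr => I _; rewrite mulrN.
Qed.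

Lemma cont_wedge3 k l (a : kform R k) (b : kform R l) :
  (forall I, cont_on (Omega Sigma) (a^~ I)) ->
  (forall I, cont_on (Omega Sigma) (b^~ I)) ->
  cont_on (Omega Sigma) (fun x => wedge3 (a x) (b x)).
Proof.
move=> ca cb; apply: cont_onM; first exact: cont_on_cst.
apply: cont_on_sum => I _; apply: cont_on_sum => J _.
by apply: cont_onM; [exact: cont_onM|exact: cont_on_cst].
Qed.

Lemma wedge3_csupp k l (a : kform R k) (b : kform R l) :
  supp_compact Sigma (fun x => a x = fun=> 0) ->
  csupp_on Sigma (fun x => wedge3 (a x) (b x)).
Proof.
move=> [K [cK KS a0]]; exists K; split => // x Ox nKx.
rewrite a0// /wedge3 big1 ?mulr0// => I _; rewrite big1// => J _.
by rewrite !mul0r.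
Qed.

Lemma is_derive_wedge3 k l (a : kform R k) (b : kform R l) x :
  smooth_form Sigma a -> smooth_form Sigma b -> Omega Sigma x ->
  is_derive x (ebase R 2) (fun y => wedge3 (a y) (b y))
    (wedge3 (a x) (partial_form 2 b x) + wedge3 (partial_form 2 a x) (b x)).
Proof.
move=> [sa _ _] [sb _ _] Ox.
have da I : is_derive x (ebase R 2) (a^~ I) (partial_form 2 a x I).
  by apply: DeriveDef => //; exact: (@derivable_smooth _ Sigma (a^~ I) 2 x (sa I) Ox).
have db J : is_derive x (ebase R 2) (b^~ J) (partial_form 2 b x J).
  by apply: DeriveDef => //; exact: (@derivable_smooth _ Sigma (b^~ J) 2 x (sb J) Ox).
have dcM c (f : pt -> R) df : is_derive x (ebase R 2) f df ->
    is_derive x (ebase R 2) (fun y => c * f y) (c * df).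
  by move=> fP; exact: is_deriveZ.
have dab I J : is_derive x (ebase R 2)
    (fun y => a y I * b y J * levi_civita R (codom I ++ codom J))
    (levi_civita R (codom I ++ codom J) *
      (a x I * partial_form 2 b x J + b x J * partial_form 2 a x I)).
  under eq_fun do rewrite mulrC; apply: dcM.
  exact: (is_deriveM (da I) (db J)).
rewrite /wedge3 -mulrDr -big_split.
apply: is_derive_eq.
  by apply: dcM; apply: is_derive_sumF => I; apply: is_derive_sumF => J; exact: dab.
congr (_ * _); apply: eq_bigr => I _ /=; rewrite -big_split; apply: eq_bigr => J _ /=.
by move: (levi_civita _ _) (a x I) (b x J) (partial_form _ _ _ _) (partial_form _ _ _ _) => *; ring.
Qed.

(** By the product rule the difference of the two integrands is the
    [e_3]-derivative of the periodic function [a /\ b]. *)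
Lemma integral_wedge_parts k l (a : kform R k) (b : kform R l) :
  smooth_form_c Sigma a -> smooth_form_c Sigma b ->
  Rintegral (@leb3 R) (cell Sigma) (fun x => wedge3 (a x) (partial_form 2 b x)) =
  Rintegral (@leb3 R) (cell Sigma) (fun x => - wedge3 (partial_form 2 a x) (b x)).
Proof.
move=> sca scb.
have [sfa supa] := sca; have [sfb supb] := scb.
have [ca _ _] := smooth_cont_form_c sca; have [cb _ _] := smooth_cont_form_c scb.
have [cda _ supda] := smooth_cont_form_c (partial_form_smooth_c oS 2 sca).
have [cdb _ _] := smooth_cont_form_c (partial_form_smooth_c oS 2 scb).
have mc := measurable_cell oS.
have dp x (Ox : Omega Sigma x) := is_derive_wedge3 sfa sfb Ox.
have int1 := cont_csupp_integrable oS (cont_wedge3 ca cdb) (wedge3_csupp (partial_form 2 b) supa).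
have int2 : (leb3 R).-integrable (cell Sigma)
    (EFin \o (fun x => - wedge3 (partial_form 2 a x) (b x))).
  apply: cont_csupp_integrable => //.
    by move=> x Ox; apply: cvgN; exact: cont_wedge3.
  have [K [cK KS w0]] := wedge3_csupp b supda.
  by exists K; split => // x Ox nKx; rewrite w0// oppr0.
apply: subr0_eq; rewrite -RintegralB//.
rewrite -(@integral_partial2_eq0 _ _ oS (fun y => wedge3 (a y) (b y))).
- apply: eq_Rintegral => x; rewrite inE => /cell_Omega Ox.
  by rewrite opprK /partial; have [_ ->] := dp x Ox.
- by move=> x Ox; have [] := dp x Ox.
- apply: (@cont_on_eq _ _ (fun x => wedge3 (a x) (partial_form 2 b x) + wedge3 (partial_form 2 a x) (b x))).
  + exact: open_Omega.
  + by move=> x Ox; rewrite /partial; have [_ ->] := dp x Ox.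
  + by apply: cont_onD; exact: cont_wedge3.
- move=> x Ox; have [[_ pa _] _] := sca; have [[_ pb _] _] := scb.
  by rewrite pa// pb.
- exact: wedge3_csupp.
Qed.

(** On smooth compactly supported forms [L_{e_3}] is the partial derivative in the
    third variable. The element of the adjoint that witnesses this is
    [- * d_3 w], since [< d_3 t, * w > vol = w /\ d_3 t] integrates to
    [- d_3 w /\ t] and [**] is the identity. *)
Lemma lie_op_smooth_c k (w : kform R k) : (k <= 3)%N -> smooth_form_c Sigma w ->
  lie_op Sigma g (@e3 R) w (partial_form 2 w).
Proof.
move=> k3 sw; have kl : (k + (3 - k) = 3)%N by rewrite subnKC.
have sz := partial_form_smooth_c oS 2 sw.
have cw := smooth_cont_form_c sw; have cz := smooth_cont_form_c sz.
split; [exact: L2form_cont_c|exact: L2form_cont_c|].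
exists (fun x I => - hodge g (l := 3 - k) (partial_form 2 w) x I); split; last first.
  apply: aeW => x cx; apply/funext => I.
  rewrite hodgeN opprK (hodge_hodge gP (cell_Omega cx))//.
  by have [[_ _ alt] _] := sz; apply: alt; exact: cell_Omega.
split.
- exact/L2form_cont_c/hodge_cont_c.
- exact/L2form_cont_c/opp_cont_c/hodge_cont_c.
move=> t _ [st ->]; rewrite lie_e3 /L2dot.
rewrite (@eq_Rintegral _ _ _ (leb3 R) (cell Sigma)
  (fun x => wedge3 (w x) (partial_form 2 t x))); last first.
  by move=> x; rewrite inE => /cell_Omega Ox; rewrite (fdot_hodge gP).
rewrite integral_wedge_parts//; apply: eq_Rintegral => x.
rewrite inE => /cell_Omega Ox.
by rewrite fdotN mulNr (fdot_hodge gP).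
Qed.

End LieOp.

(** * Averaging over the orbits of e_3 *)

Section OrbitAverage.
Variable R : realType.
Local Notation pt := (R * R * R)%type.
Local Notation I01 := ([set` `[0%R, 1%R]] : set R).

(** The flow of [- e_3], with time [s]. *)
Definition back (s : R) (x : pt) : pt := (x.1, x.2 - s).

Definition orbit_avg (G : R -> R) (h : pt -> R) (x : pt) : R :=
  Rintegral lebesgue_measure I01 (fun s => G s * h (back s x)).

Lemma continuous_back (z : R * pt) :
  {for z, continuous (fun z : R * pt => back z.1 z.2)}.
Proof.
have c1 : (fun z : R * pt => z.2.1) @ z --> z.2.1.
  by apply: (@continuous_comp _ _ _ snd fst); [exact: cvg_snd|exact: cvg_fst].
have c2 : (fun z : R * pt => z.2.2 - z.1) @ z --> z.2.2 - z.1.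
  apply: cvgB; last exact: cvg_fst.
  by apply: (@continuous_comp _ _ _ snd snd); exact: cvg_snd.
exact: (cvg_pair c1 c2).
Qed.

Variable Sigma : set (R * R).
Hypothesis oS : open Sigma.
Let oO := open_Omega oS.
Local Notation Om := (Omega Sigma).

Lemma back_Omega s x : Om x -> Om (back s x).
Proof. by case. Qed.

(** The times [s] range over a compact interval, so the closeness of the values
    at [back s y] and [back s x] holds on a neighbourhood of [x] that does
    not depend on [s]. *)
Lemma cont_on_orbit (h : pt -> R) x e : cont_on Om h -> Om x -> 0 < e ->
  \forall y \near x, forall s, I01 s -> `|h (back s y) - h (back s x)| < e.
Proof.
move=> ch Ox e0.
have K := (compact_near_coveringP _).1 (@segment_compact R 0 1).
apply: (K _ (nbhs x) (fun y s => `|h (back s y) - h (back s x)| < e)) => s _.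
have ck (z : R * pt) : Om z.2 -> {for z, continuous (fun z => h (back z.1 z.2))}.
  move=> Oz; apply: (@continuous_comp _ _ _ (fun z : R * pt => back z.1 z.2) h).
    exact: continuous_back.
  by apply: ch; exact: back_Omega.
have e20 : 0 < e / 2 by rewrite divr_gt0.
have /cvgrPdist_lt/(_ _ e20) near1 := ck (s, x) Ox.
have c2 : {for s, continuous (fun s' => h (back s' x))}.
  apply: (@continuous_comp _ _ _ (fun s' : R => (s', x)) (fun z => h (back z.1 z.2))).
    exact: (cvg_pair (@cvg_id _ (nbhs s)) (cvg_cst x (F := nbhs s))).
  exact: ck.
have /cvgrPdist_lt/(_ _ e20) near2 := c2.
have near3 : \forall z \near (s, x), `|h (back s x) - h (back z.1 x)| < e / 2.
  by apply: (cvg_fst (F := nbhs s) (G := nbhs x)) near2.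
near=> z.
have n1 : `|h (back s x) - h (back z.1 z.2)| < e / 2 by near: z.
have n3 : `|h (back s x) - h (back z.1 x)| < e / 2 by near: z.
rewrite (le_lt_trans (ler_distD (h (back s x)) _ _))// [e]splitr ltrD//.
by rewrite distrC.
Unshelve. all: by end_near. Qed.

Lemma continuous_orbit (h : pt -> R) x : cont_on Om h -> Om x ->
  continuous (fun s => h (back s x)).
Proof.
move=> ch Ox s.
apply: (@continuous_comp _ _ _ (fun s' : R => back s' x) h).
  apply: (@continuous_comp _ _ _ (fun s' : R => (s', x)) (fun z => back z.1 z.2)).
    exact: (cvg_pair (@cvg_id _ (nbhs s)) (cvg_cst x (F := nbhs s))).
  exact: continuous_back.
exact: (ch _ (back_Omega s Ox)).
Qed.

Variable G : R -> R.
Hypothesis cG : continuous G.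

Lemma integrable01 (f : R -> R) : continuous f ->
  lebesgue_measure.-integrable I01 (EFin \o f).
Proof.
move=> cf; apply: continuous_compact_integrable; first exact: segment_compact.
exact: continuous_subspaceT.
Qed.

Lemma continuous_kernel (h : pt -> R) x : cont_on Om h -> Om x ->
  continuous (fun s => G s * h (back s x)).
Proof. by move=> ch Ox s; apply: cvgM; [exact: cG|exact: continuous_orbit]. Qed.

Lemma cont_orbit_avg (h : pt -> R) : cont_on Om h -> cont_on Om (orbit_avg G h).
Proof.
move=> ch x Ox; apply/cvgrPdist_le => e e0.
have mI : measurable (I01 : set (measurableTypeR R)) by exact: measurable_itv.
pose C := Rintegral lebesgue_measure I01 (fun s => `|G s|).
have C0 : 0 <= C by exact: Rintegral_ge0.
have cnG : continuous (fun s => `|G s|).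
  by move=> s; apply: cvg_norm; exact: cG.
have e'0 : 0 < e / (C + 1) by rewrite divr_gt0// ltr_wpDl.
have Onear : nbhs x Om by exact: open_nbhs_nbhs.
have := cont_on_orbit ch Ox e'0; apply: filter_app; near=> y => hy.
have Oy : Om y by near: y.
rewrite distrC /orbit_avg -RintegralB//; try exact/integrable01/continuous_kernel.
have cB : continuous (fun s => G s * h (back s y) - G s * h (back s x)).
  by move=> s; apply: cvgB; exact: continuous_kernel.
apply: le_trans (le_normr_Rintegral mI (integrable01 cB)) _.
apply: (@le_trans _ _ (C * (e / (C + 1)))).
  rewrite -RintegralZr//; last exact: integrable01.
  apply: le_Rintegral => //.
  - by apply: integrable01 => s; apply: cvg_norm; exact: cB.
  - by apply: integrable01 => s; apply: cvgM; [exact: cnG|exact: cvg_cst].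
  - move=> s sI; rewrite -mulrBr normrM ler_wpM2l//.
    exact/ltW/hy.
rewrite mulrCA ger_pMr//.
by rewrite ler_pdivrMr ?mul1r ?lerDl// ltr_wpDl.
Unshelve. all: by end_near. Qed.

Lemma back_line s (r : R) (v x : pt) : back s (r *: v + x) = r *: v + back s x.
Proof.
by case: v x => v1 v2 [x1 x2]; rewrite /back; congr pair; rewrite /= -addrA.
Qed.

Section Partial.
Variables (i : 'I_3) (h : pt -> R).
Hypothesis dh : forall x, Om x -> derivable h x (ebase R i).
Hypothesis ch : cont_on Om h.
Hypothesis cdh : cont_on Om (partial i h).

(** Translations commute with partial derivatives, so this is differentiation under
    the integral sign; the dominating function is obtained from [cont_on_orbit],
    which bounds the derivative near the orbit of [x] by its values on the orbit
    plus one. *)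
Lemma partial_orbit_avg x : Om x ->
  derivable (orbit_avg G h) x (ebase R i) /\
  partial i (orbit_avg G h) x = orbit_avg G (partial i h) x.
Proof.
move=> Ox; set v := ebase R i.
have lineC : (fun r : R => r *: v + x) @ (0 : R) --> x.
  have : (fun r : R => r *: v + x) @ (0 : R) --> 0 *: v + x.
    by apply: cvgD; [apply: cvgZr_tmp; exact: cvg_id|exact: cvg_cst].
  by rewrite scale0r add0r.
have Onear : nbhs x Om by exact: open_nbhs_nbhs.
have [d d0 hd] : exists2 d : R, 0 < d & forall r : R, `|r| < d ->
    Om (r *: v + x) /\ forall s, I01 s ->
      `|partial i h (back s (r *: v + x)) - partial i h (back s x)| < 1.
  have n1 : nbhs (0 : R) (fun r : R => Om (r *: v + x)) := lineC _ Onear.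
  have n2 : nbhs (0 : R) (fun r : R => forall s, I01 s ->
      `|partial i h (back s (r *: v + x)) - partial i h (back s x)| < 1) :=
    lineC _ (cont_on_orbit cdh Ox ltr01).
  have : nbhs (0 : R) (fun r : R => Om (r *: v + x) /\ forall s, I01 s ->
      `|partial i h (back s (r *: v + x)) - partial i h (back s x)| < 1).
    by near=> r; split; near: r.
  move=> /nbhs_ballP[d /= d0 hd].
  exists d => // r rd; apply: hd.
  by rewrite /ball /= sub0r normrN.
pose f (r s : R) := G s * h (back s (r *: v + x)).
(* the dominating function *)
pose B (s : R) := `|G s| * (`|partial i h (back s x)| + 1).
have mI : measurable (I01 : set (measurableTypeR R)) by exact: measurable_itv.
have Ir (r : R) : [set` `](- d)%R, d[] r -> `|r| < d.
  by rewrite /= in_itv /= ltr_norml.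
have df (r s : R) : `|r| < d ->
    is_derive r (1 : R) (f ^~ s) (G s * partial i h (back s (r *: v + x))).
  move=> rd; have [Or _] := hd r rd.
  have -> : f ^~ s = G s \*: (fun r => h (r *: v + back s x)).
    by apply/funext => t; rewrite /f back_line.
  rewrite back_line; apply: is_deriveZ; apply: is_derive_line.
  by rewrite -back_line; apply: dh; exact: back_Omega.
have I0 : [set` `](- d)%R, d[] (0 : R) by rewrite /= in_itv /= oppr_lt0 d0.
have intf (r : R) : [set` `](- d)%R, d[] r ->
    lebesgue_measure.-integrable I01 (EFin \o f r).
  by move=> /Ir/hd[Or _]; exact/integrable01/continuous_kernel.
have derf (r s : R) : [set` `](- d)%R, d[] r -> I01 s -> derivable (f ^~ s) r 1.
  by move=> /Ir rd _; have [] := df r s rd.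
have B0 s : 0 <= B s by rewrite mulr_ge0// addr_ge0.
have intB : lebesgue_measure.-integrable I01 (EFin \o B).
  apply: integrable01 => s; apply: cvgM; first by apply: cvg_norm; exact: cG.
  by apply: cvgD; [apply: cvg_norm; exact: continuous_orbit|exact: cvg_cst].
have fE (r s : R) : `|r| < d ->
    partial1of2 f r s = G s * partial i h (back s (r *: v + x)).
  by move=> rd; rewrite partial1of2E; have [_ ->] := df r s rd.
have ub (r s : R) : [set` `](- d)%R, d[] r -> I01 s -> `|partial1of2 f r s| <= B s.
  move=> /Ir rd sI; rewrite fE// normrM ler_wpM2l//.
  have [_ /(_ s sI)/ltW] := hd r rd.
  by move=> /(le_trans (lerB_dist _ _)); rewrite lerBlDl.
have D := derivable_under_integral mI I0 intf derf B0 intB ub.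
have E := differentiation_under_integral mI I0 intf derf B0 intB ub.
have L := derive_line (orbit_avg G h) v x 0.
rewrite scale0r add0r in L.
split; first by rewrite -L.1.
rewrite /partial -L.2 -derive1E; apply: etrans E _.
apply: eq_Rintegral => s sI; rewrite fE ?normr0// scale0r add0r//.
Unshelve. all: by end_near. Qed.

End Partial.

End OrbitAverage.

(** * The resolvent of the derivative along the orbits *)

Section Resolvent.
Variable R : realType.
Local Notation pt := (R * R * R)%type.
Local Notation I01 := ([set` `[0%R, 1%R]] : set R).
Variable Sigma : set (R * R).
Hypothesis oS : open Sigma.
Let oO := open_Omega oS.
Local Notation Om := (Omega Sigma).

Section Smoothness.
Variable G : R -> R.
Hypothesis cG : continuous G.

(** Only the values on the open set [Om] enter the partial derivatives at its
    points, so [partial_orbit_avg] can be iterated. *)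
Lemma iter_partial_orbit_avg f s x : smooth_on Om f -> Om x ->
  foldr (@partial R) (orbit_avg G f) s x =
  orbit_avg G (foldr (@partial R) f s) x.
Proof.
move=> sf; elim: s x => [//|i s IH] x Ox /=.
rewrite (partial_eq i oO IH Ox).
apply: (partial_orbit_avg oS cG _ _ _ Ox).2.
- by move=> y Oy; have [_] := sf s y Oy; apply.
- exact: smooth_cont_on.
- exact: (@smooth_cont_on _ _ _ (i :: s)).
Qed.

Lemma smooth_orbit_avg f : smooth_on Om f -> smooth_on Om (orbit_avg G f).
Proof.
move=> sf s x Ox; split.
  apply: (@cont_on_eq _ Om (orbit_avg G (foldr (@partial R) f s))) => //.
    by move=> y Oy; rewrite iter_partial_orbit_avg.
  by apply: (cont_orbit_avg oS) => //; exact: smooth_cont_on.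
move=> i.
apply: (@derivable_eq _ Om (ebase R i) (orbit_avg G (foldr (@partial R) f s))) => //.
  by move=> y Oy; rewrite iter_partial_orbit_avg.
apply: (partial_orbit_avg oS cG _ _ _ Ox).1.
- by move=> y Oy; have [_] := sf s y Oy; apply.
- exact: smooth_cont_on.
- exact: (@smooth_cont_on _ _ _ (i :: s)).
Qed.

Definition form_avg k (a : kform R k) : kform R k :=
  fun x I => orbit_avg G (a^~ I) x.

Lemma partial_form_avg i k (a : kform R k) x I : smooth_form Sigma a -> Om x ->
  partial_form i (form_avg a) x I = orbit_avg G (partial i (a^~ I)) x.
Proof.
by move=> [sa _ _]; exact: (@iter_partial_orbit_avg (a^~ I) [:: i] x (sa I)).
Qed.

Lemma form_avg_smooth_c k (a : kform R k) : smooth_form_c Sigma a ->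
  smooth_form_c Sigma (form_avg a).
Proof.
move=> [[sa pa alt] [K [cK KS a0]]].
have mI : measurable (I01 : set (measurableTypeR R)) by exact: measurable_itv.
split; first split.
- by move=> I; exact: smooth_orbit_avg.
- move=> x Ox; apply/funext => I; apply: eq_Rintegral => s _.
  by rewrite /back /= addrAC (pa (x.1, x.2 - s)).
- move=> x Ox I s; rewrite /form_avg /orbit_avg.
  rewrite -RintegralZl//; last first.
    apply: integrable01.
    exact: (continuous_kernel cG (@smooth_cont_on _ _ _ [::] (sa I)) Ox).
  apply: eq_Rintegral => t _.
  by rewrite alt; [rewrite mulrCA|exact: back_Omega].
- exists K; split => // x Ox nKx; apply/funext => I.
  rewrite /form_avg /orbit_avg (@eq_Rintegral _ _ _ _ _ (cst 0)); last first.
    by move=> s _; rewrite a0 ?mulr0//; exact: back_Omega.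
  by rewrite Rintegral_cst// mul0r.
Qed.

End Smoothness.

Variable eta : R.
Hypothesis eta0 : eta != 0.

(** The periodic Green function of [1 + eta d/ds] on the circle: it solves
    [eta G' = - G] on [[0, 1]], and the denominator normalizes the jump
    [G 0 - G 1] to [1 / eta]. *)
Definition resolvent_kernel (s : R) : R :=
  expR (- eta^-1 * s) / (eta * (1 - expR (- eta^-1))).

Let expR_neq1 : 1 - expR (- eta^-1) != 0.
Proof.
rewrite subr_eq0 eq_sym -(@expR0 R) (inj_eq (@expR_inj R)).
by rewrite oppr_eq0 invr_eq0.
Qed.

Lemma is_derive_resolvent_kernel s :
  is_derive s (1 : R) resolvent_kernel (- eta^-1 * resolvent_kernel s).
Proof.
have d1 : is_derive s (1 : R) (fun s : R => - eta^-1 * s) (- eta^-1).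
  have := is_deriveZ (- eta^-1) (is_derive_id s (1 : R)).
  by move/is_derive_eq; apply; rewrite [LHS]mulr1.
have d2 := @is_derive1_comp _ expR (fun s : R => - eta^-1 * s) s _ _
  (is_derive_expR _) d1.
have d3 := is_deriveZ (eta * (1 - expR (- eta^-1)))^-1 d2.
rewrite /resolvent_kernel; under eq_fun do rewrite mulrC.
apply: is_derive_eq d3 _.
by rewrite /GRing.scale /=; ring.
Qed.

Lemma continuous_resolvent_kernel : continuous resolvent_kernel.
Proof.
move=> s; apply: differentiable_continuous; apply/derivable1_diffP.
by case: (is_derive_resolvent_kernel s).
Qed.

(** The integrand is the derivative of [s |-> - eta * G s * f (x - s e_3)], whose
    increment over one period is [eta * (G 0 - G 1) * f x = f x]. *)
Lemma resolvent_identity f x : smooth_on Om f -> periodic3 Sigma f -> Om x ->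
  orbit_avg resolvent_kernel f x +
    eta * orbit_avg resolvent_kernel (partial 2 f) x = f x.
Proof.
move=> sf pf Ox; set G := resolvent_kernel.
have cf : cont_on Om f by exact: (@smooth_cont_on _ _ _ [::]).
have cdf : cont_on Om (partial 2 f) by exact: (@smooth_cont_on _ _ _ [:: 2]).
have cG := continuous_resolvent_kernel.
have mI : measurable (I01 : set (measurableTypeR R)) by exact: measurable_itv.
have k1 := continuous_kernel cG cf Ox.
have k2 := continuous_kernel cG cdf Ox.
have k3 : continuous (fun s => eta * (G s * partial 2 f (back s x))).
  by move=> s; apply: cvgM; [exact: cvg_cst|exact: k2].
rewrite /orbit_avg -RintegralZl//; last exact: integrable01.
rewrite -RintegralD//; try exact: integrable01.
have dl (s : R) : is_derive s (1 : R) (fun s => f (back s x)) (- partial 2 f (back s x)).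
  have dF (r : R) : is_derive r (1 : R) (fun r => f (x.1, r)) (partial 2 f (x.1, r)).
    have -> : (fun r => f (x.1, r)) = (fun r => f (r *: ebase R 2 + (x.1, 0))).
      by apply/funext => t; rewrite ebase2 add0r.
    have -> : (x.1, r) = r *: ebase R 2 + (x.1, 0) by rewrite ebase2 add0r.
    apply: is_derive_line; rewrite ebase2.
    by apply: (@derivable_smooth _ Sigma f 2 _ sf); case: Ox.
  have dB : is_derive s (1 : R) (fun s => x.2 - s) (-1).
    have := is_deriveB (is_derive_cst (x.2 : R) s (1 : R)) (is_derive_id s (1 : R)).
    by move/is_derive_eq; apply; rewrite sub0r.
  have := @is_derive1_comp _ (fun r => f (x.1, r)) (fun s => x.2 - s) s _ _ (dF _) dB.
  by rewrite mulrN1.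
pose F (s : R) := - eta * (G s * f (back s x)).
have dF (s : R) : is_derive s (1 : R) F
    (G s * f (back s x) + eta * (G s * partial 2 f (back s x))).
  have := is_deriveZ (- eta) (is_deriveM (is_derive_resolvent_kernel s) (dl s)).
  move/is_derive_eq; apply; rewrite /GRing.scale /= -/G.
  by field.
rewrite /Rintegral (FTC2_is_derive ltr01 dF) /=; last first.
  by move=> s; apply: cvgD; [exact: k1|exact: k3].
rewrite /F.
have -> : back 0 x = x by case: x {Ox k1 k2 k3 dl F dF} => a b; rewrite /back subr0.
have -> : f (back 1 x) = f x.
  rewrite -[in LHS]pf; last exact: back_Omega.
  by case: x {Ox k1 k2 k3 dl F dF} => a b; rewrite /back /= subrK.
rewrite /G /resolvent_kernel mulr0 expR0 mulr1.
by field; rewrite eta0 expR_neq1.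
Qed.

End Resolvent.

(** Solved componentwise by averaging over the orbits of [e_3]. *)
Lemma resolvent_form (R : realType) (Sigma : set (R * R)) k (u : kform R k) eta :
  open Sigma -> smooth_form_c Sigma u ->
  exists w : kform R k, smooth_form_c Sigma w /\
    forall x, Omega Sigma x -> u x = fun I => w x I + eta * partial_form 2 w x I.
Proof.
move=> oS su; have [->|eta0] := eqVneq eta 0.
  by exists u; split => // x Ox; apply/funext => I; rewrite mul0r addr0.
have cG := @continuous_resolvent_kernel R eta.
exists (form_avg (resolvent_kernel eta) u); split; first exact: form_avg_smooth_c.
move=> x Ox; apply/funext => I; have [[su' pu _] _] := su.
rewrite (partial_form_avg oS cG)//; last by case: su.
by rewrite (resolvent_identity eta0 (su' I))// => y Oy; rewrite pu.
Qed.

(** * Density *)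

Theorem proposition4p15 (R : realType) (Sigma : set (R * R))
    (g : R * R * R -> 'M[R]_3) (k : nat) :
  open Sigma -> riemannian_metric Sigma g -> bounded_nabla Sigma g (@e3 R) ->
  (k <= 3)%N ->
  exists eta0 : R, 0 < eta0 /\
    forall eta : R, `|eta| < eta0 ->
      graph_dense Sigma g (@d_ring R Sigma g k)
        (@one_add_lie_image R Sigma g k (@e3 R) eta
           `&` dom (@d_ring R Sigma g k)).
Proof.
move=> oS gP _ k3.
(* any positive threshold works: [resolvent_form] holds for every eta *)
exists 1; split => // eta _; split; first by move=> u [].
move=> u v [_ _ approx] eps eps0.
(* the approximants provided by the closure already lie in the image *)
have [u' [v' [[su ->] u'v'eps]]] := approx eps eps0.
have L2dist0 l (a : kform R l) : L2dist Sigma g a a = 0.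
  rewrite /L2dist /L2dot (@eq_Rintegral _ _ _ _ _ (cst 0)); last first.
    move=> x _; rewrite /fdot big1 ?mulr0 ?mul0r// => I _.
    by rewrite /fsub subrr mulr0.
  by rewrite Rintegral_cst ?mul0r ?sqrtr0//; exact: measurable_cell.
have du : d_ring Sigma g u' (dform u').
  split.
  - exact/(L2form_cont_c oS gP)/smooth_cont_form_c.
  - exact/(L2form_cont_c oS gP)/dform_cont_c.
  - move=> e e0; exists u', (dform u'); split => //.
    by rewrite /graph_dist !L2dist0 expr0n addr0 sqrtr0.
exists u', (dform u'); split => //; split; last by exists (dform u').
have [w [sw uw]] := resolvent_form eta oS su.
exists w, (partial_form 2 w); split; first by case: sw.
- exact: lie_op_smooth_c.
- by apply: aeW => x /cell_Omega /uw.
Qed.
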